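(* For every real $q>2$ there is a positive constant $C_q$ depending only on $q$ such that the following holds. Let $r>0$. For each $N\in\mathbb N$, let $Z^{(N)}_i$, $i=1,2,\ldots,N$, be a sequence of independent, $\mathcal D$ valued random variables, let $M^{(N)}$ be a positive real, and let $w^{(N)}_i$, $i=1,2,\ldots,N$, be a sequence of non-negative reals. Assume that for each $N\in\mathbb N$ and $i=1,2,\ldots,N$: (i) $\mathrm E[\,Z^{(N)}_i(0,T)^q\,]^{1/q}\le M^{(N)}$; (ii) $|\mathrm E[\,Z^{(N)}_i(t_1,t_2)-Z^{(N)}_i(s_1,s_2)\,]|\le M^{(N)}w^{(N)}_i\,(|t_1-s_1|^r+|t_2-s_2|^r)$ for all $(s_1,s_2),(t_1,t_2)\in\Delta$. Put $\bar w^{(N)}=\frac1N\sum_{i=1}^N w^{(N)}_i$, and let $N_0$ be the smallest positive integer satisfying $N_0^{qr/(2qr+2r+2)}\ge 2$. Then the arithmetic average $Y^{(N)}=\frac1N\sum_{i=1}^N Z^{(N)}_i$ satisfies $$\mathrm E\Bigl[\sup_{(t_1,t_2)\in\Delta}|Y^{(N)}(t_1,t_2)-\mathrm E[Y^{(N)}(t_1,t_2)]|^q\Bigr]\le \frac{(M^{(N)})^q\,2^{q-1}}{N^{q^2r/(2qr+2r+2)}}\Bigl(C_q^q\,\bigl(2T\,(\bar w^{(N)})^{1/r}+1\bigr)+2^{2q}\Bigr)$$ for all integers $N=N_0,N_0+1,\ldots$. If in addition $\{M^{(N)},\bar w^{(N)}\}$ is bounded (i.e. both sequences are bounded in $N$)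 and $(q^2-2q-2)\,r>2$ holds, then $$\lim_{N\to\infty}\sup_{(t_1,t_2)\in\Delta}\Bigl|\frac1N\sum_{i=1}^N\bigl(Z^{(N)}_i(t_1,t_2)-\mathrm E[Z^{(N)}_i(t_1,t_2)]\bigr)\Bigr|=0\quad\text{almost surely.}$$
   Context: $T>0$ is fixed and $\Delta=\{(t_1,t_2)\in\mathbb R^2\mid 0\le t_1\le t_2\le T\}$. $\mathcal D$ denotes the set of functions $z:\Delta\to[0,\infty)$ which, for $(t_1,t_2)\in\Delta$, are non-increasing in $t_1$ and non-decreasing in $t_2$, and satisfy $z(t,t)=0$ for all $t\in[0,T]$. $(\Omega,\mathcal F,\mathrm P)$ is a probability space on which all random variables (for all $N$) are defined. A $\mathcal D$ valued random variable is a $\mathcal D$ valued $Z$ such that, for each $(t_1,t_2)\in\Delta$, $Z(t_1,t_2):\Omega\to\mathbb R$ is almost surely a real valued Borel random variable. Independence is only assumed among $i=1,\ldots,N$ for each fixed $N$; nothing is assumed about dependence or independence between variables with different $N$. $\mathbb N$ is the set of positive integers. *)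

(* Defs.v *)
From HB Require Import structures.
From mathcomp Require Import all_boot all_order all_algebra.
From mathcomp Require Import all_classical all_reals all_analysis.

Set Implicit Arguments.
Unset Strict Implicit.
Unset Printing Implicit Defensive.

Import Order.TTheory GRing.Theory Num.Theory.
Import numFieldNormedType.Exports.

Local Open Scope classical_set_scope.
Local Open Scope ring_scope.

Definition Delta (R : realType) (T : R) : set (R * R) :=
  [set t | 0 <= t.1 /\ t.1 <= t.2 /\ t.2 <= T].

(* Functions on [Delta T] are represented by total functions on [R * R] whose
   values outside [Delta T] are irrelevant. *)
Definition spaceD (R : realType) (T : R) : set (R * R -> R) :=
  [set z | [/\ forall t, Delta T t -> 0 <= z t,
               forall s1 t1 t2, Delta T (s1, t2) -> Delta T (t1, t2) ->
                 s1 <= t1 -> z (t1, t2) <= z (s1, t2),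
               forall t1 s2 t2, Delta T (t1, s2) -> Delta T (t1, t2) ->
                 s2 <= t2 -> z (t1, s2) <= z (t1, t2) &
               forall t, 0 <= t <= T -> z (t, t) = 0]].

(* "Almost surely a Borel random variable" is read as: almost surely equal to
   one.  For such functions the expectation ['E_P[X]] of the library, being an
   integral in terms of suprema over simple functions, is that of the equal
   random variable. *)
Definition ae_random_variable d (Omega : measurableType d) (R : realType)
    (P : probability Omega R) (X : Omega -> R) : Prop :=
  exists X' : {RV P >-> R}, {ae P, forall om, X om = X' om}.

Definition D_random_variable d (Omega : measurableType d) (R : realType)
    (P : probability Omega R) (T : R) (Z : Omega -> R * R -> R) : Prop :=
  (forall om, spaceD T (Z om)) /\
  (forall t, Delta T t -> ae_random_variable P (fun om => Z om t)).

Definition sigma_D (Omega : Type) (R : realType) (T : R)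
    (Z : Omega -> R * R -> R) : set (set Omega) :=
  <<s [set A | exists t B, [/\ Delta T t, measurable B &
                               A = (fun om => Z om t) @^-1` B]] >>.

(* Mutual independence of the sigma-algebras generated by the [Z i].  As
   [Z i ^~ t] is only almost surely equal to a measurable function, an event
   [A i] of [sigma_D T (Z i)] need not be measurable; its probability is that of
   any measurable [E i] differing from it by a negligible set (when all
   [Z i ^~ t] are measurable, taking [E i := A i] gives the usual product
   rule). *)
Definition D_independent d (Omega : measurableType d) (R : realType)
    (P : probability Omega R) (T : R) (I : finType)
    (Z : I -> Omega -> R * R -> R) : Prop :=
  forall (J : {set I}) (A E : I -> set Omega),
    (forall i, i \in J ->
      [/\ sigma_D T (Z i) (A i), measurable (E i) &
          P.-negligible (A i `+` E i)]) ->
    P (\bigcap_(i in [set` J]) E i) = (\prod_(i in J) P (E i))%E.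

Definition average (R : realType) (N : nat) (x : 'I_N -> R) : R :=
  N%:R^-1 * \sum_(i < N) x i.

Definition is_N0 (R : realType) (q r : R) (N0 : nat) : Prop :=
  let large (n : nat) :=
    (0 < n)%N /\ 2 <= n%:R `^ (q * r / (2 * q * r + 2 * r + 2)) in
  large N0 /\ forall n, large n -> (N0 <= n)%N.

(* Main.v *)
Require Import Defs.
From HB Require Import structures.
From mathcomp Require Import all_boot all_order all_algebra.
From mathcomp Require Import all_classical all_reals all_analysis.
From mathcomp Require Import measurable_realfun.
From mathcomp Require Import ring lra.

(** The supremum over the triangle is reduced to finitely many points, where a
    moment inequality for sums of independent variables applies; the number of
    points is then chosen so that the two resulting errors balance.

    Moments at a fixed point.  If [S] and [X] are independent and [X] is
    centered, expanding [|S + X|^q] to second order around [S] ([powR_normD_le])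
    gives [E|S + X|^q <= E|S|^q + c (E|S|^(q-2) E X^2 + E|X|^q)], the linear term
    having mean zero.  Young's inequality at the scale [sqrt N] replaces
    [|S|^(q-2)] by [N^(q/2-1) + |S|^q / N], so that each of the [N] summands
    multiplies the moment by [1 + c'/N] and adds [O(N^(q/2-1))].  Iterating,
    [E|S_N|^q = O(N^(q/2))] ([sum_moment]).

    Finite net.  The sample functions and their mean [G] are monotone in both
    arguments, so a sample function is squeezed between its values at the
    neighbours of a point in a grid, and its distance to [G] is controlled by
    the distance at the grid points as soon as [G] varies little between
    neighbours.  The first coordinate is cut uniformly: by Hoelder continuity
    [O(T w^(1/r) eps^(-1/r))] intervals make [G] vary by at most [M eps].  For
    each of these abscissae [u] the second coordinate is cut at level points of
    the monotone function [G(u, .)], whose range has length at most [2 M]: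
    [O(1/eps)] points are enough, whatever the modulus of continuity.  The total
    is linear in [T w^(1/r)], with the factor [eps^(-1-1/r)] ([finite_net]).

    Balance.  Summing the moments over the net gives, up to constants,
    [M^q eps^(-1-1/r) N^(-q/2)], and the discretization adds [(4 M eps)^q].
    With [eps = N^(-qr/(2qr+2r+2))] both are of order [M^q eps^q]
    ([rate_balance]).

    Almost sure convergence.  The exponent [q^2 r / (2qr+2r+2)] of the bound
    exceeds [1] exactly when [(q^2-2q-2) r > 2].  The bounds are then summable,
    so almost surely the majorants of the [q]-th powers of the deviations have a
    finite sum and tend to [0] ([ae_cvg0_of_summable]).

    Neither the supremum nor the values of the processes are measurable in
    general.  The values are replaced by measurable versions at the finitely
    many points of the net, and the supremum is dominated almost surely by a
    measurable function ([deviation_majorant]); the integral of a nonnegative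
    function being a supremum over simple functions below it, such a domination
    still bounds the integral ([ae_le_integral_ge0]). *)

Set Implicit Arguments.
Unset Strict Implicit.
Unset Printing Implicit Defensive.

Import Order.TTheory GRing.Theory Num.Theory.
Import numFieldNormedType.Exports.

Local Open Scope classical_set_scope.
Local Open Scope ring_scope.

(** * Inequalities between powers *)

Section RealInequalities.
Variable R : realType.
Implicit Types a b q t x y : R.

Lemma one_powR q : 1 `^ q = 1.
Proof. by rewrite powR1. Qed.

(** From [(1 - x) expR x <= 1]; beyond [x = 1/2] the factor [2] is no longer
    enough for [1 / (1 - x)]. *)
Lemma expR_le_quad x : x <= 2^-1 -> expR x <= 1 + x + 2 * x ^+ 2.
Proof.
move=> x2.
have e0 : 0 < expR x by exact: expR_gt0.
have : (1 - x) * expR x <= 1.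
  apply: (@le_trans _ _ (expR (- x) * expR x)).
    by rewrite ler_pM2r// expR_ge1Dx.
  by rewrite -expRD addNr expR0.
have -> : 1 + x + 2 * x ^+ 2 = (1 - x)^-1 + x ^+ 2 * (1 - 2 * x) / (1 - x).
  by field; lra.
move=> h; apply: (@le_trans _ _ (1 - x)^-1).
  by rewrite -[leRHS]mulr1 ler_pdivlMl//; lra.
by rewrite lerDl divr_ge0//; [rewrite mulr_ge0// ?sqr_ge0//; lra | lra].
Qed.

(** Second-order bound obtained from [ln (1 + t) <= t] and [expR_le_quad]. *)
Lemma powR_1D_le q t : 0 <= q -> -1 < t -> q * t <= 2^-1 ->
  (1 + t) `^ q <= 1 + q * t + 2 * q ^+ 2 * t ^+ 2.
Proof.
move=> q0 t1 qt.
rewrite -mulrA -exprMn; apply: le_trans (expR_le_quad qt).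
rewrite /powR gt_eqF; last by lra.
by rewrite ler_expR ler_wpM2l// le_ln1Dx.
Qed.

(** The first summand serves when [|b|] is small compared to [|a| / q], the
    other two bound [|a + b|^q] and the linear term when it is not. *)
Definition taylor_const q := 2 * q ^+ 2 + (2 * q + 1) `^ q + q * (2 * q) `^ (q - 1).

Lemma taylor_const_ge0 q : 0 <= q -> 0 <= taylor_const q.
Proof. by move=> q0; rewrite !addr_ge0 ?mulr_ge0 ?powR_ge0 ?sqr_ge0. Qed.

Lemma powR_normD_le_pos q a b : 2 < q -> 0 <= a ->
  `|a + b| `^ q <= a `^ q + q * a `^ (q - 1) * b
    + taylor_const q * (a `^ (q - 2) * b ^+ 2 + `|b| `^ q).
Proof.
move=> q2 a0.
have q0 : 0 < q by lra.
have c0 := taylor_const_ge0 (ltW q0).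
(* Below this threshold [q * |b / a| <= 1/2], the range of [expR_le_quad]. *)
have [ab|ab] := leP (2 * q * `|b|) a.
- have [->|aN0] := eqVneq a 0.
    rewrite add0r !powR0 ?gt_eqF//; try lra.
    rewrite mulr0 !mul0r !add0r ler_peMl ?powR_ge0//.
    have : 1 <= (2 * q + 1) `^ q.
      by rewrite -[leLHS](one_powR q) ge0_ler_powR ?nnegrE//; lra.
    rewrite /taylor_const.
    have : 0 <= 2 * q ^+ 2 by rewrite mulr_ge0// sqr_ge0.
    have : 0 <= q * (2 * q) `^ (q - 1) by rewrite mulr_ge0// ?powR_ge0// ltW.
    lra.
  have {aN0 a0} a0 : 0 < a by rewrite lt_neqAle eq_sym aN0.
  pose t := b / a.
  have bE : b = a * t by rewrite /t mulrCA divff ?gt_eqF// mulr1.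
  have ht : 2 * q * `|t| <= 1.
    by rewrite /t normrM normfV (gtr0_norm a0) mulrA ler_pdivrMr// mul1r.
  have t2 : `|t| <= 4^-1.
    have := normr_ge0 t; nra.
  have /ler_normlP[t3 t4] := t2.
  have -> : `|a + b| = a * (1 + t).
    rewrite bE -{1}(mulr1 a) -mulrDr ger0_norm// mulr_ge0//; lra.
  rewrite powRM ?(ltW a0)//; last lra.
  have qt : q * t <= 2^-1 by have := ler_norm t; nra.
  have := @powR_1D_le q t (ltW q0) ltac:(lra) qt.
  rewrite -(ler_pM2l (powR_gt0 q a0)) => /le_trans; apply.
  have E2 : a `^ (q - 2) * b ^+ 2 = a `^ q * t ^+ 2.
    rewrite bE exprMn mulrA; congr (_ * _).
    rewrite -powR_mulrn ?(ltW a0)// -powRD; first by congr (_ `^ _); lra.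
    by rewrite (gt_eqF a0) implybT.
  have E1 : q * a `^ (q - 1) * b = a `^ q * (q * t).
    by rewrite bE -(@mulr_powRB1 _ a q (ltW a0) q0); ring.
  rewrite E1 E2 mulrDr mulrDr mulr1 lerD2l.
  set A := a `^ q; have A0 : 0 <= A by exact: powR_ge0.
  apply: (@le_trans _ _ (taylor_const q * (A * t ^+ 2))).
    rewrite [leLHS]mulrCA ler_wpM2r//; first by apply: mulr_ge0; rewrite ?sqr_ge0.
    rewrite /taylor_const -addrA lerDl addr_ge0 ?powR_ge0// mulr_ge0 ?powR_ge0//.
    exact: ltW.
  by rewrite ler_wpM2l// lerDl powR_ge0.
- have b0 : 0 < `|b| by have := normr_ge0 b; nra.
  set B := `|b| `^ q; have B0 : 0 <= B by exact: powR_ge0.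
  have H1 : `|a + b| `^ q <= (2 * q + 1) `^ q * B.
    rewrite /B -powRM//; last lra.
    rewrite ge0_ler_powR ?nnegrE ?(ltW q0)//.
      by rewrite mulr_ge0//; lra.
    by rewrite (le_trans (ler_normD _ _))// (ger0_norm a0); lra.
  have H2 : - (q * a `^ (q - 1) * b) <= q * (2 * q) `^ (q - 1) * B.
    rewrite -mulrN -!mulrA ler_pM2l//.
    apply: (@le_trans _ _ (a `^ (q - 1) * `|b|)).
      by rewrite ler_wpM2l ?powR_ge0// -normrN ler_norm.
    rewrite /B -(@mulr_powRB1 _ `|b| q)// (mulrC `|b|) mulrA ler_pM2r//.
    rewrite -powRM//; last lra.
    by rewrite ge0_ler_powR ?nnegrE//; [lra|rewrite mulr_ge0//; lra|exact: ltW].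
  have H3 : 0 <= taylor_const q * (a `^ (q - 2) * b ^+ 2).
    by rewrite mulr_ge0// mulr_ge0// ?powR_ge0// sqr_ge0.
  have H4 : 0 <= a `^ q by exact: powR_ge0.
  have H5 : 0 <= 2 * q ^+ 2 * B by rewrite mulr_ge0// mulr_ge0// sqr_ge0.
  rewrite mulrDr.
  have -> : taylor_const q * B = 2 * q ^+ 2 * B + (2 * q + 1) `^ q * B
     + q * (2 * q) `^ (q - 1) * B by rewrite /taylor_const; ring.
  lra.
Qed.

(** Expansion to second order around [a]; the remainder is split into the part
    that is quadratic in [b] and the part that dominates for large [b]. *)
Lemma powR_normD_le q a b : 2 < q ->
  `|a + b| `^ q <= `|a| `^ q + q * `|a| `^ (q - 1) * Num.sg a * b
    + taylor_const q * (`|a| `^ (q - 2) * b ^+ 2 + `|b| `^ q).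
Proof.
move=> q2; have [a0|a0|->] := ltrgtP a 0; last first.
- have := @powR_normD_le_pos q 0 b q2 (lexx 0).
  have q1 : q - 1 != 0 by rewrite gt_eqF//; lra.
  by rewrite normr0 sgr0 (powR0 q1) !mulr0 !mul0r.
- have := @powR_normD_le_pos q a b q2 (ltW a0).
  by rewrite (gtr0_norm a0) gtr0_sg// mulr1.
- have := @powR_normD_le_pos q (- a) (- b) q2 ltac:(lra).
  rewrite -opprD !normrN (ltr0_norm a0) ltr0_sg// sqrrN => /le_trans; apply.
  by rewrite !lerD2r lerD2l !mulrN mulr1 mulNr.
Qed.

(** Convexity of the power at the midpoint of [a] and [b]. *)
Lemma powRD_convex q a b : 1 <= q -> 0 <= a -> 0 <= b ->
  (a + b) `^ q <= 2 `^ (q - 1) * (a `^ q + b `^ q).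
Proof.
move=> q1 a0 b0.
have h0 : (0 : R) <= 2^-1 by lra.
have h1 : (2^-1 : R) <= 1 by lra.
pose t : {i01 R} := Itv01 h0 h1.
have := @convex_powR R q q1 t a b.
rewrite !inE /= !in_itv /= !andbT => /(_ a0 b0).
rewrite convRE /= => cvx.
have : (2^-1 * a + (1 - 2^-1) * b) `^ q
    <= 2^-1 * a `^ q + (1 - 2^-1) * b `^ q := cvx.
rewrite (_ : 1 - 2^-1 = 2^-1 :> R); last lra.
rewrite -!mulrDr powRM ?addr_ge0//.
rewrite powRB ?implybT; last by rewrite pnatr_eq0 implybT.
rewrite -powR_inv1// -!powRrM mulN1r (powRN _ q).
rewrite powRr1// powR_inv1//.
set A := (a + b) `^ q; set B := _ + _ => h.
have p0 : 0 < (2 : R) `^ q by exact: powR_gt0.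
rewrite -(ler_pM2l (_ : 0 < (2 `^ q)^-1)) ?invr_gt0// (le_trans h)//.
by rewrite !mulrA mulVf ?gt_eqF// mul1r.
Qed.

(** According to whether [s <= L], one of the two terms alone is enough. *)
Lemma powR_sub2_young q s L : 2 < q -> 0 <= s -> 0 < L ->
  s `^ (q - 2) <= L `^ (q - 2) + s `^ q / L ^+ 2.
Proof.
move=> q2 s0 L0; have [sL|Ls] := leP s L.
  rewrite ler_wpDr ?divr_ge0 ?powR_ge0 ?sqr_ge0//.
  by rewrite ge0_ler_powR ?nnegrE ?(ltW L0)//; lra.
rewrite ler_wpDl ?powR_ge0// ler_pdivlMr ?exprn_gt0//.
have s1 : 0 < s by lra.
rewrite (_ : s `^ q = s `^ (q - 2) * s ^+ 2).
  by rewrite ler_wpM2l ?powR_ge0// lerXn2r ?nnegrE//; lra.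
rewrite -powR_mulrn// -powRD ?(gt_eqF s1) ?implybT//; congr (_ `^ _); lra.
Qed.

Lemma powR_le1D p q s : 0 <= s -> 0 <= p -> p <= q -> s `^ p <= 1 + s `^ q.
Proof.
move=> s0 p0 pq; have [s1|s1] := leP s 1.
  rewrite ler_wpDr ?powR_ge0// -(one_powR p).
  by rewrite ge0_ler_powR ?nnegrE.
by rewrite ler_wpDl// ler_powR// ltW.
Qed.

End RealInequalities.

(** * Partial sums of independent variables *)

Section IndependentSums.
Local Open Scope ereal_scope.
Context d (Omega : measurableType d) (R : realType) (P : probability Omega R).

(** The part of the product event that concerns the variables not yet summed
    when [partial_sum X k] has been formed. *)
Definition tail_event (X : nat -> {mfun Omega >-> R}) (N k : nat) (B : nat -> set R) :=
  \bigcap_(i in [set i | (k <= i < N)%N]) (X i @^-1` B i).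

(** Mutual independence of [X 0, ..., X N.-1], in the form of a factorization
    peeling off one variable at a time; this is what the induction on partial
    sums consumes. *)
Definition chain_independent (N : nat) (X : nat -> {mfun Omega >-> R}) :=
  forall k (B : nat -> set R), (k < N)%N -> (forall i, measurable (B i)) ->
    P (tail_event X N k B) = P (X k @^-1` B k) * P (tail_event X N k.+1 B).

Lemma measurable_tail_event X N k B : (forall i, measurable (B i)) ->
  measurable (tail_event X N k B).
Proof.
move=> mB; apply: bigcap_measurableType => i _.
by rewrite -[X in measurable X]setTI; exact: measurable_funP.
Qed.

Lemma tail_eventS X N k B : (k < N)%N ->
  tail_event X N k B = X k @^-1` B k `&` tail_event X N k.+1 B.
Proof.
move=> kN; apply/seteqP; split=> om.
  move=> h; split; first by apply: h => /=; rewrite leqnn.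
  by move=> i /= /andP[ki iN]; apply: h => /=; rewrite (ltnW ki).
move=> [h0 h1] i /= /andP[]; rewrite leq_eqVlt => /predU1P[<-//|ki iN].
by apply: h1; rewrite /= ki.
Qed.

Lemma tail_event_setT X N k B : (forall i, B i = setT) ->
  tail_event X N k B = setT.
Proof. by move=> BT; apply/seteqP; split=> // om _ i _ /=; rewrite BT. Qed.

(** Once normalized by [P C], the law of [(U, V)] restricted to [C] agrees with
    the product law on rectangles, hence everywhere.  The event [C] carries the
    variables that come later. *)
Lemma product_law (U V : {mfun Omega >-> R}) (C : set Omega) : measurable C ->
  (forall A B, measurable A -> measurable B ->
    P (U @^-1` A `&` V @^-1` B `&` C) = P (U @^-1` A) * P (V @^-1` B) * P C) ->
  forall E : set (R * R), measurable E ->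
  P ([set om | E (U om, V om)] `&` C) =
    (distribution P U \x distribution P V) E * P C.
Proof.
move=> mC UVC E mE.
have mUV : measurable_fun setT (fun om => (U om, V om)).
  by apply: measurable_fun_pair; exact: measurable_funP.
have mEE : measurable [set om | E (U om, V om)].
  by rewrite -[X in measurable X]setTI; exact: mUV.
have Cfin : P C \is a fin_num by exact: fin_num_measure.
have [PC0|PC0] := eqVneq (P C) 0.
  rewrite PC0 mule0; apply/eqP; rewrite eq_le measure_ge0 andbT -PC0.
  by rewrite le_measure ?inE//; exact: measurableI.
(* Here [P C > 0], and dividing by it turns the restriction to [C] into a
   probability to which uniqueness of the product measure applies. *)
pose c : R := fine (P C).
have c0 : (0 < c)%R by rewrite fine_gt0// lt0e PC0 measure_ge0/= ltey_eq Cfin.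
have cE : P C = c%:E by rewrite fineK.
pose m0 := measure_function_pushforward__canonical__measure_function_Measure
  (mrestr P mC) mUV.
have ci0 : (0 <= c^-1)%R by rewrite invr_ge0 ltW.
pose ci : {nonneg R} := NngNum ci0.
have -> : (distribution P U \x distribution P V) E = mscale ci m0 E.
  apply: product_measure_unique => // A B mA mB.
  change ((c^-1)%:E * P (U @^-1` A `&` V @^-1` B `&` C) =
    P (U @^-1` A) * P (V @^-1` B)).
  by rewrite UVC// cE muleCA -EFinM mulVf ?gt_eqF// mule1.
rewrite /mscale/= muleAC cE -EFinM mulVf ?gt_eqF// mul1e.
by rewrite /pushforward /mrestr.
Qed.

Definition partial_sum (X : nat -> {mfun Omega >-> R}) (k : nat) (om : Omega) : R :=
  (\sum_(i < k) X i om)%R.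

Lemma measurable_partial_sum X k : measurable_fun setT (partial_sum X k).
Proof. by apply: measurable_sum => i; exact: measurable_funP. Qed.

HB.instance Definition _ X k :=
  isMeasurableFun.Build _ _ _ _ (partial_sum X k) (measurable_partial_sum X k).

Lemma partial_sumS X k om : partial_sum X k.+1 om = (partial_sum X k om + X k om)%R.
Proof. by rewrite /partial_sum big_ord_recr. Qed.

(** Induction on [k]: a condition on [partial_sum X k.+1] is a Borel condition
    on the pair [(partial_sum X k, X k)], which by [product_law] is independent
    of the remaining tail. *)
Lemma partial_sum_indep N X : chain_independent N X ->
  forall k (A : set R) B, (k <= N)%N -> measurable A ->
    (forall i, measurable (B i)) ->
    P (partial_sum X k @^-1` A `&` tail_event X N k B) =
    P (partial_sum X k @^-1` A) * P (tail_event X N k B).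
Proof.
move=> indX; elim=> [|k IH] A B kN mA mB.
  have [A0|A0] := pselect (A 0%R).
    rewrite (_ : _ @^-1` A = setT) ?setTI ?probability_setT ?mul1e//.
    by apply/seteqP; split => // om _; rewrite /= /partial_sum big_ord0.
  rewrite (_ : _ @^-1` A = set0) ?set0I ?measure0 ?mul0e//.
  by apply/seteqP; split => // om; rewrite /= /partial_sum big_ord0.
have law B' : (forall i, measurable (B' i)) ->
    P (partial_sum X k.+1 @^-1` A `&` tail_event X N k.+1 B') =
    (distribution P (partial_sum X k) \x distribution P (X k))
      [set z | A (z.1 + z.2)%R] * P (tail_event X N k.+1 B').
  move=> mB'; rewrite -product_law//.
  - congr (P (_ `&` _)); apply/seteqP.
    by split=> om /=; rewrite partial_sumS.
  - exact: measurable_tail_event.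
  - move=> A1 B1 mA1 mB1.
    (* The condition on [X k] is put back in front of the tail. *)
    pose B2 i := if i == k then B1 else B' i.
    have mB2 i : measurable (B2 i) by rewrite /B2; case: ifP.
    have tE : tail_event X N k.+1 B2 = tail_event X N k.+1 B'.
      apply: eq_bigcapr => i /= /andP[ki _].
      by rewrite /B2 gtn_eqF.
    have B2k : B2 k = B1 by rewrite /B2 eqxx.
    have := IH A1 B2 (ltnW kN) mA1 mB2.
    by rewrite indX// tail_eventS// tE B2k setIA muleA.
  - rewrite -[X in measurable X]setTI.
    exact: (measurable_funD measurable_fst measurable_snd).
have := law (fun=> setT) (fun=> measurableT).
rewrite tail_event_setT// setIT probability_setT mule1 => ->.
exact: law.
Qed.

Lemma partial_sum_law N X k : chain_independent N X -> (k < N)%N ->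
  forall E : set (R * R), measurable E ->
  P [set om | E (partial_sum X k om, X k om)] =
    (distribution P (partial_sum X k) \x distribution P (X k)) E.
Proof.
move=> indX kN E mE.
have := @product_law (partial_sum X k) (X k) setT measurableT _ E mE.
rewrite setIT probability_setT mule1; apply => A B mA mB.
pose B2 i := if i == k then B else setT.
have mB2 i : measurable (B2 i) by rewrite /B2; case: ifP.
have tE : tail_event X N k.+1 B2 = setT.
  rewrite -(tail_event_setT X N k.+1 (fun=> erefl)).
  by apply: eq_bigcapr => i /= /andP[ki _]; rewrite /B2 gtn_eqF.
have B2k : B2 k = B by rewrite /B2 eqxx.
have := partial_sum_indep indX (ltnW kN) mA mB2.
by rewrite indX// tail_eventS// tE B2k setIA probability_setT !setIT !mule1.
Qed.

(** Independence in the form in which it is used: integrate out the last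
    variable with the partial sum frozen. *)
Lemma integral_partial_sum_law N X k : chain_independent N X -> (k < N)%N ->
  forall f : R * R -> \bar R, measurable_fun setT f -> (forall z, 0 <= f z) ->
  \int[P]_om f (partial_sum X k om, X k om) =
  \int[distribution P (partial_sum X k)]_s \int[distribution P (X k)]_x f (s, x).
Proof.
move=> indX kN f mf f0.
rewrite -fubini_tonelli1//.
have mUV : measurable_fun setT (fun om => (partial_sum X k om, X k om)).
  by apply: measurable_fun_pair; exact: measurable_funP.
pose m0 := measure_function_pushforward__canonical__measure_function_Measure
  P mUV.
rewrite -(@eq_measure_integral _ _ _ setT _ m0).
  by rewrite ge0_integral_pushforward.
by move=> E mE _; exact: partial_sum_law indX kN _ mE.
Qed.

End IndependentSums.

(** * Moments of sums of independent centered variables *)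

Section Moments.
Local Open Scope ereal_scope.
Context d (Omega : measurableType d) (R : realType) (P : probability Omega R).

Lemma measurable_powR_norm d' (T : measurableType d') (f : T -> R) (p : R) :
  measurable_fun setT f -> measurable_fun setT (fun x => (`|f x| `^ p)%:E).
Proof.
move=> mf; apply/measurable_EFinP.
apply: (measurableT_comp (measurable_powR p)).
exact: (measurableT_comp (@normr_measurable _ setT)).
Qed.

(** Integral of [powR_normD_le] at [a = s]: the linear term vanishes, and
    [X^2 <= 1 + |X|^q] bounds the second moment. *)
Lemma centered_shift_moment (q m s : R) (X : {mfun Omega >-> R}) :
  (2 < q)%R ->
  P.-integrable setT (EFin \o X) -> \int[P]_om (X om)%:E = 0 ->
  \int[P]_om (`|X om| `^ q)%:E <= m%:E ->
  \int[P]_om (`|s + X om| `^ q)%:E <=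
    (`|s| `^ q + taylor_const q * (`|s| `^ (q - 2) * (1 + m) + m))%:E.
Proof.
move=> q2 iX X0 Xm.
have c0 := @taylor_const_ge0 R q ltac:(lra).
set c := taylor_const q in c0 *.
set a2 := (`|s| `^ (q - 2))%R.
have a20 : (0 <= a2)%R by exact: powR_ge0.
have mX : measurable_fun setT X by exact: measurable_funP.
have mXq := measurable_powR_norm q mX.
pose K0 := (`|s| `^ q + c * a2)%R.
pose B := (q * `|s| `^ (q - 1) * Num.sg s)%R.
pose K1 := (c * (a2 + 1))%R.
have K10 : (0 <= K1)%R by rewrite mulr_ge0// addr_ge0.
have iXq : P.-integrable setT (fun om => (`|X om| `^ q)%:E).
  apply/integrableP; split => //.
  under eq_integral do rewrite gee0_abs ?lee_fin ?powR_ge0//.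
  by rewrite (le_lt_trans Xm)// ltry.
pose h om := (K0%:E + B%:E * (X om)%:E) + K1%:E * (`|X om| `^ q)%:E.
have leh om : (`|s + X om| `^ q)%:E <= h om.
  rewrite /h -!EFinM -!EFinD lee_fin (le_trans (powR_normD_le s (X om) q2))//.
  rewrite -/c -/a2 -/B.
  have x2 : (X om ^+ 2 <= 1 + `|X om| `^ q)%R.
    rewrite -(real_normK (num_real (X om))) -powR_mulrn//.
    by apply: powR_le1D => //; lra.
  have : (a2 * X om ^+ 2 <= a2 * (1 + `|X om| `^ q))%R by rewrite ler_wpM2l.
  move=> /(ler_wpM2l c0); rewrite /K0 /K1; lra.
have iB : P.-integrable setT (fun om => B%:E * (X om)%:E) by exact: integrableZl.
have iK : P.-integrable setT (fun om => K1%:E * (`|X om| `^ q)%:E) by exact: integrableZl.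
have iK0 : P.-integrable setT (cst K0%:E) by exact: finite_measure_integrable_cst.
have iKB : P.-integrable setT (fun om => K0%:E + B%:E * (X om)%:E) by exact: integrableD.
apply: (@le_trans _ _ (\int[P]_om h om)).
  apply: ge0_le_integral => //.
  - by apply: measurable_powR_norm; exact: measurable_funD.
  - by have [] := integrableP _ _ _ (integrableD measurableT iKB iK).
rewrite integralD// integralD// integral_cst//.
rewrite [X in _ * X + _](_ : _ = 1); last exact: probability_setT.
rewrite mule1.
rewrite integralZl// X0 mule0 adde0 integralZl//.
have : K1%:E * (\int[P]_om (`|X om| `^ q)%:E) <= K1%:E * m%:E.
  by rewrite lee_wpmul2l.
move/(leeD (lexx K0%:E))/le_trans; apply.
by rewrite -EFinM -EFinD lee_fin /K0 /K1; nra.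
Qed.

(** [centered_shift_moment] is integrated over the law of the partial sum; the
    moment of order [q - 2] is traded for that of order [q] by
    [powR_sub2_young] at a free scale [L]. *)
Lemma partial_sum_moment_step (q m L : R) N (X : nat -> {mfun Omega >-> R}) k :
  (2 < q)%R -> (0 <= m)%R -> (0 < L)%R ->
  chain_independent P N X -> (k < N)%N ->
  P.-integrable setT (EFin \o X k) -> \int[P]_om (X k om)%:E = 0 ->
  \int[P]_om (`|X k om| `^ q)%:E <= m%:E ->
  \int[P]_om (`|partial_sum X k.+1 om| `^ q)%:E <=
    (1 + taylor_const q * (1 + m) / L ^+ 2)%:E *
      \int[P]_om (`|partial_sum X k om| `^ q)%:E
    + (taylor_const q * ((1 + m) * L `^ (q - 2) + m))%:E.
Proof.
move=> q2 m0 L0 indX kN iX X0 Xm.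
have c0 := @taylor_const_ge0 R q ltac:(lra).
set c := taylor_const q in c0 *.
have mf : measurable_fun setT (fun z : R * R => (`|z.1 + z.2| `^ q)%:E).
  apply: measurable_powR_norm.
  exact: (measurable_funD measurable_fst measurable_snd).
have f0 (z : R * R) : 0 <= (`|z.1 + z.2| `^ q)%:E by rewrite lee_fin powR_ge0.
under eq_integral do rewrite partial_sumS.
rewrite (integral_partial_sum_law indX kN mf f0).
set g := (1 + _)%R; set b := (c * _)%R.
have g0 : (0 <= g)%R.
  by rewrite addr_ge0// divr_ge0 ?sqr_ge0// mulr_ge0// addr_ge0.
have b0 : (0 <= b)%R.
  by rewrite mulr_ge0// addr_ge0// mulr_ge0 ?powR_ge0// addr_ge0.
have mn : measurable_fun setT (fun s : R => (`|s| `^ q)%:E).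
  by apply: measurable_powR_norm; exact: measurable_id.
have mgn : measurable_fun setT (fun s : R => g%:E * (`|s| `^ q)%:E).
  exact: measurable_funeM.
rewrite -(@ge0_integral_distribution _ _ _ _ _ P (partial_sum X k)
  (fun s => (`|s| `^ q)%:E))//.
rewrite -ge0_integralZl//.
rewrite -[X in _ <= _ + X]mule1 -(probability_setT (distribution P (partial_sum X k))).
rewrite -integral_cst// -ge0_integralD//; last first.
  by move=> y _; rewrite mule_ge0// lee_fin powR_ge0.
apply: ge0_le_integral => //.
- by move=> s _; apply: integral_ge0 => x _; exact: (f0 (s, x)).
- exact: (@measurable_fun_fubini_tonelli_F _ _ _ _ _
    (distribution P (X k)) _ mf f0).
- exact: emeasurable_funD.
move=> s _.
have ms : measurable_fun setT (fun x : R => (`|s + x| `^ q)%:E).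
  by apply: measurable_powR_norm; exact: measurable_funD.
rewrite (@ge0_integral_distribution _ _ _ _ _ P (X k)
  (fun x => (`|s + x| `^ q)%:E))//.
apply: (le_trans (centered_shift_moment s q2 iX X0 Xm)).
rewrite -/c -EFinM -EFinD lee_fin /g /b.
have := powR_sub2_young q2 (normr_ge0 s) L0.
set u := (`|s| `^ (q - 2))%R; set v := (`|s| `^ q)%R => uv.
have : (c * (1 + m) * u <= c * (1 + m) * (L `^ (q - 2) + v / L ^+ 2))%R.
  by rewrite ler_wpM2l// mulr_ge0// addr_ge0.
by rewrite (_ : (1 + c * (1 + m) / L ^+ 2) * v = v + c * (1 + m) * (v / L ^+ 2))%R; lra.
Qed.

(** The exponential bounds the [N]-fold product of the factors
    [1 + c (1 + m) / N] given by [partial_sum_moment_step]. *)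
Definition moment_const (q m : R) : R :=
  taylor_const q * (1 + 2 * m) * expR (taylor_const q * (1 + m)).

(** Iteration of [partial_sum_moment_step] with [L = sqrt N], the typical size
    of the sum, for which the growth factors multiply to a constant. *)
Lemma sum_moment (q m : R) N (X : nat -> {mfun Omega >-> R}) :
  (2 < q)%R -> (0 <= m)%R -> (0 < N)%N ->
  chain_independent P N X ->
  (forall k, (k < N)%N ->
   [/\ P.-integrable setT (EFin \o X k), \int[P]_om (X k om)%:E = 0 &
       \int[P]_om (`|X k om| `^ q)%:E <= m%:E]) ->
  \int[P]_om (`|partial_sum X N om| `^ q)%:E
    <= (moment_const q m * N%:R `^ (q / 2))%:E.
Proof.
move=> q2 m0 N0 indX hX.
have c0 := @taylor_const_ge0 R q ltac:(lra).
rewrite /moment_const; set c := taylor_const q in c0 *.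
have Np : (0 < N%:R :> R)%R by rewrite ltr0n.
pose L := (N%:R `^ 2^-1 : R)%R.
have L0 : (0 < L)%R by exact: powR_gt0.
have L2 : (L ^+ 2 = N%:R)%R.
  by rewrite -powR_mulrn ?ltW// -powRrM mulVf// powRr1 ?ltW.
pose g := (c * (1 + m) / N%:R)%R.
have g0 : (0 <= g)%R by rewrite divr_ge0// mulr_ge0// addr_ge0.
pose b := (c * ((1 + m) * L `^ (q - 2) + m))%R.
have b0 : (0 <= b)%R.
  by rewrite mulr_ge0// addr_ge0// mulr_ge0 ?powR_ge0// addr_ge0.
have H k : (k <= N)%N -> \int[P]_om (`|partial_sum X k om| `^ q)%:E <=
    (k%:R * b * (1 + g) ^+ k)%:E.
  elim: k => [|k IH] kN.
    rewrite !mul0r integral0_eq// => om _.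
    by rewrite /partial_sum big_ord0 normr0 powR0// gt_eqF//; lra.
  have [iX X0 Xm] := hX k kN.
  apply: (le_trans (partial_sum_moment_step q2 m0 L0 indX kN iX X0 Xm)).
  rewrite L2 -/c -/b -/g.
  apply: (@le_trans _ _ ((1 + g)%:E * (k%:R * b * (1 + g) ^+ k)%:E + b%:E)).
    rewrite leeD2r// lee_wpmul2l ?lee_fin ?addr_ge0//.
    exact/IH/ltnW.
  rewrite -EFinM -EFinD lee_fin.
  have : (b <= b * (1 + g) ^+ k.+1)%R.
    by rewrite ler_peMr// exprn_ege1// lerDl.
  by rewrite exprS -natr1; set t := ((1 + g) ^+ k)%R => ?; lra.
apply: (le_trans (H N (leqnn N))); rewrite lee_fin.
have e1 : ((1 + g) ^+ N <= expR (c * (1 + m)))%R.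
  apply: (@le_trans _ _ (expR g ^+ N)%R).
    rewrite lerXn2r ?nnegrE ?expR_ge0 ?expR_ge1Dx ?addr_ge0//.
  rewrite -expRM_natl /g mulrC divfK// gt_eqF//.
have L1 : (1 <= L `^ (q - 2))%R.
  rewrite -[leLHS](one_powR (q - 2)) ge0_ler_powR ?nnegrE ?(ltW L0)//; try lra.
  rewrite -[leLHS](one_powR 2^-1) ge0_ler_powR ?nnegrE//.
  by rewrite ler1n.
have b1 : (b <= c * (1 + 2 * m) * L `^ (q - 2))%R.
  rewrite /b -mulrA ler_wpM2l//.
  have : (m <= m * L `^ (q - 2))%R by rewrite ler_peMr.
  lra.
have NL : (N%:R * L `^ (q - 2) = N%:R `^ (q / 2))%R.
  rewrite /L -powRrM -{1}(powRr1 (ltW Np)) -powRD; last first.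
    by rewrite (gt_eqF Np) implybT.
  by congr (_ `^ _)%R; lra.
rewrite -NL.
apply: (@le_trans _ _ (N%:R * (c * (1 + 2 * m) * L `^ (q - 2)) * expR (c * (1 + m))))%R.
  apply: ler_pM => //; [by rewrite mulr_ge0| |].
    by rewrite exprn_ge0// addr_ge0.
  by rewrite ler_wpM2l.
rewrite le_eqVlt; apply/orP; left; apply/eqP; ring.
Qed.

End Moments.

(** * Integrals of almost surely measurable functions *)

Section NonMeasurableIntegrands.
Local Open Scope ereal_scope.
Context d (Omega : measurableType d) (R : realType).
Import HBNNSimple.

(** Monotonicity holds for arbitrary nonnegative functions, since enlarging the
    function only adds simple functions below it. *)
Lemma le_integral_ge0 (mu : {measure set Omega -> \bar R}) (f g : Omega -> \bar R) :
  (forall x, 0 <= f x) -> (forall x, f x <= g x) ->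
  \int[mu]_x f x <= \int[mu]_x g x.
Proof.
move=> f0 fg; have g0 x : 0 <= g x by exact: le_trans (fg x).
rewrite !ge0_integralTE//; apply: ereal_sup_le => _ [h hf <-].
exists h => // x.
exact: le_trans (hf x) (fg x).
Qed.

(** Every simple function below [f] is almost everywhere below the measurable
    [g], and for these two the usual comparison applies. *)
Lemma ae_le_integral_ge0 (mu : {measure set Omega -> \bar R}) (f g : Omega -> \bar R) :
  (forall x, 0 <= f x) -> (forall x, 0 <= g x) -> measurable_fun setT g ->
  {ae mu, forall x, f x <= g x} ->
  \int[mu]_x f x <= \int[mu]_x g x.
Proof.
move=> f0 g0 mg fg; rewrite [leLHS]ge0_integralTE//.
apply: ge_ereal_sup => _ [h hf <-]; rewrite -integralT_nnsfun.
apply: ae_ge0_le_integral => //.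
- by move=> x _; rewrite lee_fin.
- exact/measurable_EFinP.
- by apply: filterS fg => x fgx _; exact: le_trans (hf x) fgx.
Qed.

(** For the converse inequality, [g] is set to zero on an exceptional null set,
    which changes neither its integral nor its measurability and puts it below
    [f] everywhere. *)
Lemma ae_eq_integral_ge0 (mu : {measure set Omega -> \bar R}) (f g : Omega -> \bar R) :
  (forall x, 0 <= f x) -> (forall x, 0 <= g x) -> measurable_fun setT g ->
  {ae mu, forall x, f x = g x} ->
  \int[mu]_x f x = \int[mu]_x g x.
Proof.
move=> f0 g0 mg fg; apply/eqP; rewrite eq_le; apply/andP; split.
  by apply: ae_le_integral_ge0 => //; apply: filterS fg => x ->.
have [N [mN N0 sN]] := fg.
rewrite (ge0_negligible_integral mN measurableT mg)//.
rewrite integral_mkcond; apply: le_integral_ge0 => x.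
  by rewrite patchE; case: ifP.
rewrite patchE; case: ifPn => // /set_mem [_ xN].
suff -> : f x = g x by [].
by apply: contrapT => fgx; apply: xN; exact: sN.
Qed.

Context (P : probability Omega R).

Lemma ae_eq_expectation (X : Omega -> R) (X' : {mfun Omega >-> R}) :
  {ae P, forall om, X om = X' om} -> 'E_P[X] = 'E_P[X'].
Proof.
move=> XX'; rewrite unlock integralE [RHS]integralE.
have mX' : measurable_fun setT (EFin \o X') by exact/measurable_EFinP.
congr (_ - _); apply: ae_eq_integral_ge0 => //.
- exact: measurable_funepos.
- by apply: filterS XX' => om e; rewrite !funeposE /= e.
- exact: measurable_funeneg.
- by apply: filterS XX' => om e; rewrite !funenegE /= e.
Qed.

End NonMeasurableIntegrands.

(** * Finite nets for monotone functions of two variables *)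

Section Nets.
Context (R : realType).

Lemma bracket_index (v : nat -> R) n t : v 0%N <= t -> t <= v n.+1 ->
  exists l, (l <= n)%N /\ v l <= t <= v l.+1.
Proof.
move=> v0 ; elim: n => [|n IH] vn; first by exists 0%N; rewrite v0 vn.
have [/IH[l [ln lt]]|/ltW nt] := leP t (v n.+1).
  by exists l; split => //; exact: leqW.
by exists n.+1; rewrite nt vn.
Qed.

(** Since [g] is continuous, it attains each of the equally spaced levels
    between [0] and [g b]; the two ends are fixed to be [a] and [b] so that the
    points cover the interval even where [g] is constant. *)
Lemma level_points (g : R -> R) a b n : a <= b ->
  {within `[a, b], continuous g} -> g a = 0 -> 0 <= g b ->
  exists v : nat -> R,
    [/\ v 0%N = a, v n.+1 = b, forall l, a <= v l <= b &
        forall l, (l <= n)%N -> g (v l.+1) - g (v l) = g b / n.+1%:R].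
Proof.
move=> ab cg ga gb.
have ex l : exists c, (a <= c <= b) /\ ((l <= n)%N -> g c = l%:R * (g b / n.+1%:R)).
  have [ln|ln] := leqP l n; last by exists a; rewrite lexx ab.
  have [|c] := @IVT R g a b (l%:R * (g b / n.+1%:R)) ab cg.
    rewrite ga min_l// max_r// mulr_ge0 ?divr_ge0//=.
    rewrite mulrCA ler_piMr// ler_pdivrMr// mul1r ler_nat.
    exact: leqW.
  by rewrite in_itv /= => cab gc; exists c.
have {ex} [f hf] := choice ex.
pose v l := if l == 0%N then a else if (l <= n)%N then f l else b.
have vE l : (l <= n.+1)%N -> g (v l) = l%:R * (g b / n.+1%:R).
  rewrite /v; case: eqVneq => [-> _|l0 ln1]; first by rewrite ga mul0r.
  case: leqP => [ln|nl] /=; first by have [_ ->] := hf l.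
  have -> : l = n.+1 by apply/eqP; rewrite eqn_leq ln1 nl.
  by rewrite mulrCA divff ?mulr1// pnatr_eq0.
exists v; split.
- by [].
- by rewrite /v /= ltnn.
- move=> l; rewrite /v; case: ifP; first by rewrite lexx ab.
  by case: ifP => [_ _|_ _]; [have [] := hf l|rewrite lexx ab].
- move=> l ln; rewrite !vE//; last exact: leqW.
  by rewrite -mulrBl -natr1 addrC addKr mul1r.
Qed.

Lemma hoelder_continuous (g : R -> R) a b c r : 0 < r -> 0 <= c ->
  (forall x y, a <= x <= b -> a <= y <= b -> `|g x - g y| <= c * `|x - y| `^ r) ->
  {within `[a, b], continuous g}.
Proof.
move=> r0 c0 hg; apply/subspace_continuousP => x /= xab.
apply/cvgrPdist_le => e e0.
have c1 : 0 < c + 1 by lra.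
have de : 0 < (e / (c + 1)) `^ r^-1 by rewrite powR_gt0// divr_gt0.
near=> y.
have yab : a <= y <= b by near: y; rewrite near_withinE; near=> y.
apply: (le_trans (hg x y _ yab)); first by move: xab; rewrite in_itv.
apply: (@le_trans _ _ ((c + 1) * (e / (c + 1)))); last by rewrite mulrCA divff ?gt_eqF// mulr1.
apply: ler_pM; rewrite ?powR_ge0//; first lra.
have -> : e / (c + 1) = (e / (c + 1)) `^ r^-1 `^ r.
  by rewrite -powRrM mulVf ?gt_eqF// powRr1// divr_ge0// ltW.
apply: ge0_ler_powR; rewrite ?nnegrE ?(ltW r0) ?(ltW de)//.
near: y; rewrite near_withinE; near=> y => _.
by near: y; exact: cvgr_dist_le.
Unshelve. all: by end_near.
Qed.

(** Monotonicity of [y] in both arguments sandwiches [y t] between its values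
    at net points whose [G]-values are within [3 A eps] of [G t]: [A eps] for the
    step in the first coordinate and [2 A eps] for one level of [G (u, .)].  The
    upper neighbour uses the abscissa to the left of [t] and the lower one that
    to the right, which may leave the triangle; near the diagonal, [G t] itself
    is at most [A eps] and [0 <= y t] is a sufficient lower bound. *)
Lemma finite_net (T r W A eps : R) (G : R * R -> R) :
  0 < T -> 0 < r -> 0 <= W -> 0 < A -> 0 < eps -> eps <= 1 ->
  spaceD T G -> (forall t, Delta T t -> G t <= 2 * A) ->
  (forall s t, Delta T s -> Delta T t ->
     `|G t - G s| <= A * W * (`|t.1 - s.1| `^ r + `|t.2 - s.2| `^ r)) ->
  exists pts : seq (R * R),
    [/\ forall p, p \in pts -> Delta T p,
        (size pts)%:R <= 6 * (2 * T * W `^ r^-1 + 1) * (eps^-1 * (eps^-1) `^ r^-1) &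
        forall y, spaceD T y -> forall c,
          (forall p, p \in pts -> `|y p - G p| <= c) ->
          forall t, Delta T t -> `|y t - G t| <= c + 4 * A * eps].
Proof.
move=> T0 r0 W0 A0 e0 e1 [G0 Gdec Ginc Gdiag] G2 Ghol.
set E := (eps^-1) `^ r^-1.
have ie1 : 1 <= eps^-1 by rewrite invf_ge1.
have ie0 : 0 < eps^-1 by rewrite invr_gt0.
have ir0 : 0 < r^-1 by rewrite invr_gt0.
have E1 : 1 <= E by rewrite -[leLHS](one_powR r^-1) ge0_ler_powR ?nnegrE ?(ltW ir0) ?(ltW ie0).
pose w := W `^ r^-1.
have w0 : 0 <= w by exact: powR_ge0.
have TwE0 : 0 <= T * w * E by rewrite !mulr_ge0 ?(ltW T0) ?powR_ge0.
(* [K.+1] intervals in the first coordinate, [n.+1] levels in the second. *)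
pose K := Num.truncn (T * w * E).
pose n := Num.truncn eps^-1.
have KT : T * w * E < K.+1%:R by exact: truncnS_gt.
have KT' : K%:R <= T * w * E by rewrite truncn_le.
have nE : eps^-1 < n.+1%:R by exact: truncnS_gt.
have nE' : n%:R <= eps^-1 by rewrite truncn_le// ltW.
have K0 : (0 : R) < K.+1%:R by [].
pose delta := T / K.+1%:R.
have delta0 : 0 <= delta by rewrite divr_ge0// ltW.
have Wdelta : W * delta `^ r <= eps.
  have h : delta * w * E <= 1.
    by rewrite /delta mulrAC -mulrA mulrAC mulrA ler_pdivrMr// mul1r ltW// mulrAC.
  have E0 : 0 <= E by exact: powR_ge0.
  have dw0 : 0 <= delta * w by exact: mulr_ge0.
  have h0 : 0 <= delta * w * E by exact: mulr_ge0.
  have : (delta * w * E) `^ r <= 1.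
    by rewrite -[leRHS](one_powR r) ge0_ler_powR ?nnegrE ?(ltW r0).
  rewrite (powRM _ dw0 E0) (powRM _ delta0 w0).
  rewrite /w /E -!powRrM mulVf ?gt_eqF// !powRr1 ?(ltW ie0)//.
  by rewrite ler_pdivrMr// mul1r mulrC.
pose u j := delta * j%:R.
have u00 : u 0%N = 0 by rewrite /u mulr0.
have uKT : u K.+1 = T by rewrite /u divfK// gt_eqF.
have uS j : u j.+1 = u j + delta by rewrite /u -natr1 mulrDr mulr1.
have u0 j : 0 <= u j by rewrite mulr_ge0.
have uT j : (j <= K.+1)%N -> u j <= T.
  by move=> jK; rewrite -uKT /u ler_wpM2l// ler_nat.
have uD j x : u j <= x <= T -> Delta T (u j, x).
  by move=> /andP[h1 h2]; split => //=.
have levels j : exists v : nat -> R, (j <= K.+1)%N ->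
    [/\ v 0%N = u j, v n.+1 = T, forall l, u j <= v l <= T &
    forall l, (l <= n)%N ->
       G (u j, v l.+1) - G (u j, v l) = G (u j, T) / n.+1%:R].
  have [jK|jK] := leqP j K.+1; last by exists u.
  have [||||v hv] := @level_points (fun x => G (u j, x)) (u j) T n.
  - exact: uT.
  - apply: (@hoelder_continuous _ _ _ (A * W) r) => //.
      by rewrite mulr_ge0// ltW.
    move=> x y hx hy; have := Ghol _ _ (uD j y hy) (uD j x hx).
    by rewrite /= subrr normr0 powR0 ?gt_eqF// add0r.
  - by apply: Gdiag; rewrite u0 uT.
  - by apply/G0/uD; rewrite uT//= lexx.
  by exists v.
have {levels} [v hv] := choice levels.
pose pts := [seq (u j, v j l) | j <- iota 0 K.+2, l <- iota 0 n.+2].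
have ptsP j l : (j <= K.+1)%N -> (l <= n.+1)%N -> (u j, v j l) \in pts.
  by move=> jK ln; apply/allpairsP; exists (j, l); rewrite !mem_iota.
exists pts; split.
- move=> _ /allpairsP[[j l] [jK _ ->]].
  have {}jK : (j <= K.+1)%N by move: jK; rewrite mem_iota.
  by have [_ _ hv1 _] := hv j jK; exact: uD.
- rewrite size_allpairs !size_iota natrM.
  rewrite (_ : 6 * _ * _ = (2 * (2 * T * w + 1) * E) * (3 * eps^-1)); last by rewrite -/E -/w; ring.
  apply: ler_pM => //.
    rewrite -addn2 natrD.
    have : 0 <= T * w by rewrite mulr_ge0 // ltW.
    by move=> ?; nra.
  by rewrite -addn2 natrD; lra.
move=> y [y0 ydec yinc ydiag] c hc t [t0 [t12 t2T]].
case: t t0 t12 t2T => t1 t2 /= t0 t12 t2T.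
have tD : Delta T (t1, t2) by [].
have c0 : 0 <= c by apply: le_trans (hc _ (ptsP 0%N 0%N isT isT)).
have inc j l : (j <= K.+1)%N -> (l <= n)%N ->
    G (u j, v j l.+1) - G (u j, v j l) <= 2 * A * eps.
  move=> jK ln; have [_ _ _ ->//] := hv j jK.
  apply: (@le_trans _ _ (2 * A / n.+1%:R)).
    by rewrite ler_wpM2r ?invr_ge0//; apply/G2/uD; rewrite uT//= lexx.
  rewrite ler_wpM2l ?mulr_ge0 ?ltW//.
  by rewrite invf_plt ?posrE.
have Gstep (a b x : R) : Delta T (a, x) -> Delta T (b, x) -> `|a - b| <= delta ->
    `|G (a, x) - G (b, x)| <= A * eps.
  move=> aD bD ab; apply: (le_trans (Ghol _ _ bD aD)) => /=.
  rewrite subrr normr0 powR0 ?gt_eqF// addr0 -mulrA ler_pM2l//.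
  apply: le_trans Wdelta; rewrite ler_wpM2l// ge0_ler_powR ?nnegrE//.
  exact: ltW.
(* [t1] lies between the abscissae [u j] and [u j.+1]. *)
have [||j [jK /andP[ut1 tu1]]] := @bracket_index u K t1.
- by rewrite u00.
- by rewrite uKT; lra.
have jK1 : (j <= K.+1)%N by exact: leqW.
have ujt2 : u j <= t2 <= T by apply/andP; split=> //; lra.
have st : `|t1 - u j| <= delta.
  by rewrite ger0_norm ?subr_ge0//; move: tu1; rewrite uS; lra.
have GA : G (u j, t2) <= G (t1, t2) + A * eps.
  have := Gstep _ _ _ tD (uD _ _ ujt2) st; rewrite ler_norml; lra.
rewrite ler_norml; apply/andP; split.
- have [ut2|ut2] := leP (u j.+1) t2.
    have uj2 : u j.+1 <= t2 <= T by rewrite ut2.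
    have [v0 vn vb _] := hv j.+1 jK.
    have [||l [ln /andP[vt tv]]] := @bracket_index (v j.+1) n t2.
    + by rewrite v0.
    + by rewrite vn.
    have st' : `|t1 - u j.+1| <= delta.
      by rewrite ler0_norm ?subr_le0//; move: ut1; rewrite uS; lra.
    have h1 := Gstep _ _ _ tD (uD _ _ uj2) st'.
    have h2 := inc j.+1 l jK ln.
    have h3 := hc _ (ptsP j.+1 l jK (leqW ln)).
    have h4 := ydec _ _ _ tD (uD _ _ uj2) tu1.
    have h5 := yinc _ _ _ (uD _ _ (vb l)) (uD _ _ uj2) vt.
    have h6 := Ginc _ _ _ (uD _ _ uj2) (uD _ _ (vb l.+1)) tv.
    move: h1 h3; rewrite !ler_norml => /andP[h1 h1'] /andP[h3 h3'].
    lra.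
  (* The point [(u j.+1, t2)] is outside the triangle: [t] is near the diagonal. *)
  have h1 := y0 _ tD.
  have ujj : u j <= u j <= T by rewrite lexx uT.
  have h2 := Ghol _ _ (uD _ _ ujj) (uD _ _ ujt2).
  have h3 : `|G (u j, t2) - G (u j, u j)| <= A * eps.
    apply: (le_trans h2) => /=; rewrite subrr normr0 powR0 ?gt_eqF// add0r.
    rewrite -mulrA ler_pM2l//; apply: le_trans Wdelta.
    rewrite ler_wpM2l// ge0_ler_powR ?nnegrE ?(ltW r0)//.
    rewrite ger0_norm ?subr_ge0; first by move: ut2; rewrite uS; lra.
    by case/andP: ujt2.
  have h4 : G (t1, t2) <= G (u j, t2) by exact: Gdec (uD _ _ ujt2) tD ut1.
  move: h3; rewrite Gdiag ?u0 ?uT//= subr0 ler_norml => /andP[_ h3].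
  have : 0 < A * eps by exact: mulr_gt0.
  lra.
- have [v0 vn vb _] := hv j jK1.
  have [||l [ln /andP[vt tv]]] := @bracket_index (v j) n t2.
  + by rewrite v0; case/andP: ujt2.
  + by rewrite vn.
  have h2 := inc j l jK1 ln.
  have h3 := hc _ (ptsP j l.+1 jK1 ln).
  have h4 := ydec _ _ _ (uD _ _ ujt2) tD ut1.
  have h5 := yinc _ _ _ (uD _ _ ujt2) (uD _ _ (vb l.+1)) tv.
  have h6 := Ginc _ _ _ (uD _ _ (vb l)) (uD _ _ ujt2) vt.
  move: h3; rewrite !ler_norml => /andP[h3 h3'].
  have : 0 < A * eps by exact: mulr_gt0.
  lra.
Qed.

End Nets.

(** * The mean function of a single process *)

Section SingleProcess.
Local Open Scope ereal_scope.
Context d (Omega : measurableType d) (R : realType) (P : probability Omega R).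
Variables (T q M : R) (Z : Omega -> R * R -> R).
Hypotheses (T0 : (0 < T)%R) (q2 : (2 < q)%R) (M0 : (0 < M)%R).
Hypothesis ZD : forall om, spaceD T (Z om).
Hypothesis Zq : 'E_P[fun om => (Z om (0, T) `^ q)%R] `^ q^-1 <= M%:E.

Definition mean_fun (t : R * R) : R := fine 'E_P[fun om => Z om t].

Lemma spaceD_ge0 (z : R * R -> R) t : spaceD T z -> Delta T t -> (0 <= z t)%R.
Proof. by case=> z0 _ _ _; exact: z0. Qed.

Lemma spaceD_le_corner (z : R * R -> R) t : spaceD T z -> Delta T t ->
  (z t <= z (0, T))%R.
Proof.
case: t => t1 t2 [_ zd zi _] tD; have [/= h0 [h1 h2]] := tD.
have D0 : Delta T (0, t2)%R by split => /=; [lra|split; lra].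
have DT : Delta T (0, T)%R by split => /=; [lra|split; have := T0; lra].
exact: le_trans (zd _ _ _ D0 tD h0) (zi _ _ _ D0 DT h2).
Qed.

(** The [q]-th root being taken in the extended reals, the hypothesis also
    says that the moment is finite. *)
Lemma corner_moment : \int[P]_om (Z om (0, T) `^ q)%:E <= (M `^ q)%:E.
Proof.
have q0 : (0 < q)%R by have := q2; lra.
move: Zq; rewrite unlock.
have : 0 <= \int[P]_om (Z om (0, T) `^ q)%:E.
  by apply: integral_ge0 => om _; rewrite lee_fin powR_ge0.
case: (\int[P]_om _) => [e|_|//] /=; last first.
  by rewrite gt_eqF// invr_gt0.
rewrite !lee_fin => e0 eM.
rewrite -(powRr1 e0) -(@mulVf _ q) ?gt_eqF// powRrM.
by rewrite ge0_ler_powR ?nnegrE ?powR_ge0 ?(ltW q0) ?(ltW M0).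
Qed.

(** Among all points of the triangle, [Z] is largest at the corner [(0, T)]. *)
Lemma version_moment t (X : {mfun Omega >-> R}) : Delta T t ->
  {ae P, forall om, Z om t = X om} ->
  \int[P]_om (`|X om| `^ q)%:E <= (M `^ q)%:E.
Proof.
move=> tD ZX; apply: le_trans corner_moment.
rewrite -(@ae_eq_integral_ge0 _ _ _ _ (fun om => (`|Z om t| `^ q)%:E))//.
- apply: le_integral_ge0 => om; first by rewrite lee_fin powR_ge0.
  have z0 := spaceD_ge0 (ZD om) tD.
  have z1 := spaceD_le_corner (ZD om) tD.
  rewrite lee_fin ger0_norm// ge0_ler_powR ?nnegrE ?(le_trans z0 z1)//; have := q2; lra.
- by apply: measurable_powR_norm; exact: measurable_funP.
- by apply: filterS ZX => om ->.
Qed.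

(** Homogeneous form of [y <= 1 + y^q] at [y = |x| / M]; it yields
    integrability and the bound [2 M] on the mean. *)
Lemma norm_le_moment (x : R) : (`|x| <= M + M `^ (1 - q) * `|x| `^ q)%R.
Proof.
have h := @powR_le1D R 1%R q (`|x| / M)%R (divr_ge0 (normr_ge0 x) (ltW M0)) ler01
  ltac:(have := q2; lra).
have : (M * (`|x| / M) `^ 1 <= M * (1 + (`|x| / M) `^ q))%R.
  by rewrite ler_pM2l.
rewrite powRr1; last by rewrite divr_ge0// ltW.
rewrite mulrCA divff ?gt_eqF// mulr1 mulrDr mulr1 powRM ?invr_ge0 ?(ltW M0)//.
rewrite -powR_inv1 ?(ltW M0)// -powRrM mulN1r mulrCA.
rewrite -{2}(powRr1 (ltW M0)) -powRD ?(mulrC (`|x| `^ q)%R)//.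
by rewrite (gt_eqF M0) implybT.
Qed.

Lemma version_integrable t (X : {mfun Omega >-> R}) : Delta T t ->
  {ae P, forall om, Z om t = X om} -> P.-integrable setT (EFin \o X).
Proof.
move=> tD ZX; have Xq := version_moment tD ZX.
have mX : measurable_fun setT X by exact: measurable_funP.
have mXq := measurable_powR_norm q mX.
apply/integrableP; split; first exact/measurable_EFinP.
have iXq : P.-integrable setT (fun om => (`|X om| `^ q)%:E).
  apply/integrableP; split => //.
  under eq_integral do rewrite gee0_abs ?lee_fin ?powR_ge0//.
  by rewrite (le_lt_trans Xq)// ltry.
have iB : P.-integrable setT (fun om => M%:E + (M `^ (1 - q))%:E * (`|X om| `^ q)%:E).
  apply: integrableD => //; first exact: finite_measure_integrable_cst.
  exact: integrableZl.
apply: (le_lt_trans _ (integrable_lty measurableT iB)) => //.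
apply: ge0_le_integral => //.
- by apply/measurable_EFinP; exact: (measurableT_comp (@normr_measurable _ setT)).
- by have [] := integrableP _ _ _ iB.
- by move=> om _; rewrite /= -EFinM -EFinD lee_fin norm_le_moment.
Qed.

Hypothesis ZX : forall t, Delta T t -> ae_random_variable P (fun om => Z om t).

Lemma mean_fin t : Delta T t -> 'E_P[fun om => Z om t] = (mean_fun t)%:E.
Proof.
move=> tD; have [X ZX'] := ZX tD.
have iX := version_integrable tD ZX'.
rewrite /mean_fun fineK// (ae_eq_expectation ZX') unlock.
exact: integrable_fin_num.
Qed.

Lemma mean_version t (X : {mfun Omega >-> R}) : Delta T t ->
  {ae P, forall om, Z om t = X om} -> \int[P]_om (X om)%:E = (mean_fun t)%:E.
Proof. by move=> tD ZX'; rewrite -mean_fin// (ae_eq_expectation ZX') unlock. Qed.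

Lemma mean_integral t : Delta T t -> \int[P]_om (Z om t)%:E = (mean_fun t)%:E.
Proof. by move=> tD; rewrite -mean_fin// unlock. Qed.

Lemma mean_le s t : Delta T s -> Delta T t -> (forall om, Z om s <= Z om t)%R ->
  (mean_fun s <= mean_fun t)%R.
Proof.
move=> sD tD st; rewrite -lee_fin -!mean_integral//.
by apply: le_integral_ge0 => om; rewrite lee_fin ?st ?(spaceD_ge0 (ZD om)).
Qed.

Lemma mean_spaceD : spaceD T mean_fun.
Proof.
split.
- move=> t tD; rewrite -lee_fin -mean_integral//.
  by apply: integral_ge0 => om _; rewrite lee_fin (spaceD_ge0 (ZD om)).
- move=> s1 t1 t2 sD tD st; apply: mean_le => // om.
  by have [_ + _ _] := ZD om; exact.
- move=> t1 s2 t2 sD tD st; apply: mean_le => // om.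
  by have [_ _ + _] := ZD om; exact.
- move=> t tT; rewrite /mean_fun (_ : (fun om => Z om (t, t)) = cst 0%R).
    by rewrite expectation_cst.
  by apply/funext => om /=; have [_ _ _ ->] := ZD om.
Qed.

Lemma mean_le2M t : Delta T t -> (mean_fun t <= 2 * M)%R.
Proof.
move=> tD; have [X ZX'] := ZX tD.
have Xq := version_moment tD ZX'.
have mX : measurable_fun setT X by exact: measurable_funP.
have mXq := measurable_powR_norm q mX.
rewrite -lee_fin -mean_integral//.
pose c : R := (M `^ (1 - q))%R.
have c0 : 0 <= c%:E by rewrite lee_fin powR_ge0.
apply: (@le_trans _ _ (\int[P]_om ((cst M%:E om) + c%:E * (`|X om| `^ q)%:E))).
  apply: ae_le_integral_ge0.
  - by move=> om; rewrite lee_fin (spaceD_ge0 (ZD om)).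
  - by move=> om; rewrite -EFinM -EFinD lee_fin addr_ge0 ?mulr_ge0 ?powR_ge0 ?(ltW M0).
  - by apply: emeasurable_funD => //; exact: measurable_funeM.
  - apply: filterS ZX' => om e; rewrite -EFinM -EFinD lee_fin.
    apply: le_trans (norm_le_moment _); rewrite e; exact: ler_norm.
rewrite ge0_integralD//; last 3 first.
- by move=> om _; rewrite lee_fin (ltW M0).
- by move=> om _; rewrite mule_ge0// lee_fin powR_ge0.
- exact: measurable_funeM.
rewrite integral_cst// ge0_integralZl//.
rewrite [X in _ * X + _](_ : _ = 1); last exact: probability_setT.
rewrite mule1.
have : c%:E * \int[P]_om (`|X om| `^ q)%:E <= c%:E * (M `^ q)%:E.
  by rewrite lee_wpmul2l.
move/(leeD (lexx M%:E))/le_trans; apply.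
rewrite -EFinM -EFinD lee_fin /c -powRD ?(gt_eqF M0) ?implybT//.
by rewrite subrK powRr1 ?(ltW M0)// -mulr2n mulr_natl.
Qed.

Lemma mean_diff s t : Delta T s -> Delta T t ->
  'E_P[fun om => (Z om t - Z om s)%R] = (mean_fun t - mean_fun s)%:E.
Proof.
move=> sD tD; have [X ZX'] := ZX tD; have [Y ZY'] := ZX sD.
have XY : {ae P, forall om, (Z om t - Z om s)%R = (X - Y : {mfun Omega >-> R})%R om}.
  by apply: filterS2 ZX' ZY' => om -> ->.
rewrite (ae_eq_expectation XY) unlock.
under eq_integral do rewrite /= EFinB.
rewrite integralB_EFin//; last 2 first.
- exact: version_integrable ZX'.
- exact: version_integrable ZY'.
by rewrite (mean_version tD ZX') (mean_version sD ZY').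
Qed.

(** Bound for the [q]-th moment of [(X - E X) / M], by convexity from
    [E|X|^q <= M^q] and [E X <= 2 M]. *)
Definition centered_moment_const : R := 2 `^ (q - 1) * (1 + 2 `^ q).

Lemma standardized_moment t (X : {mfun Omega >-> R}) (xi : {mfun Omega >-> R}) :
  Delta T t -> {ae P, forall om, Z om t = X om} ->
  (forall om, xi om = (X om - mean_fun t) / M)%R ->
  [/\ P.-integrable setT (EFin \o xi), \int[P]_om (xi om)%:E = 0 &
      \int[P]_om (`|xi om| `^ q)%:E <= centered_moment_const%:E].
Proof.
move=> tD ZX' xiE.
have iX := version_integrable tD ZX'.
have Xq := version_moment tD ZX'.
have mX : measurable_fun setT X by exact: measurable_funP.
have mXq := measurable_powR_norm q mX.
have F0 : (0 <= mean_fun t)%R by apply: spaceD_ge0 mean_spaceD tD.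
have F2 := mean_le2M tD.
have EX := mean_version tD ZX'.
have xiE' : EFin \o xi = (fun om => (M^-1)%:E * ((X om)%:E - (mean_fun t)%:E)).
  by apply/funext => om /=; rewrite xiE mulrC EFinM EFinB.
have iF : P.-integrable setT (cst (mean_fun t)%:E).
  exact: finite_measure_integrable_cst.
have iXF : P.-integrable setT (fun om => (X om)%:E - (mean_fun t)%:E).
  exact: integrableB.
split.
- by rewrite xiE'; exact: integrableZl.
- rewrite (_ : (fun om => (xi om)%:E) = EFin \o xi)// xiE' integralZl//.
  rewrite integralB// integral_cst// EX.
  rewrite [X in _ - _ * X](_ : _ = 1); last exact: probability_setT.
  by rewrite mule1 subee// mule0.
pose c : R := (2 `^ (q - 1))%R.
have c0 : (0 <= c)%R by exact: powR_ge0.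
have Mi : (0 <= M^-1)%R by rewrite invr_ge0 ltW.
apply: (@le_trans _ _ (\int[P]_om
    ((c * M^-1 `^ q)%:E * (`|X om| `^ q)%:E + cst (c * 2 `^ q)%:E om))).
  apply: ge0_le_integral => //.
  - by apply: measurable_powR_norm; exact: measurable_funP.
  - by apply: emeasurable_funD => //; exact: measurable_funeM.
  move=> om _; rewrite -EFinM -EFinD lee_fin xiE normrM (ger0_norm Mi).
  have q1 : (1 <= q)%R by have := q2; lra.
  apply: (@le_trans _ _ ((`|X om| * M^-1 + 2) `^ q)%R).
    rewrite ge0_ler_powR ?nnegrE ?mulr_ge0 ?addr_ge0 ?mulr_ge0//; first by have := q2; lra.
    apply: (@le_trans _ _ ((`|X om| + 2 * M) * M^-1)%R).
      rewrite ler_wpM2r// (le_trans (ler_normB _ _))// lerD2l ger0_norm//.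
    by rewrite mulrDl mulfK// gt_eqF.
  apply: (le_trans (powRD_convex q1 _ _)) => //; first by rewrite mulr_ge0.
  by rewrite powRM// -/c; lra.
rewrite ge0_integralD//; last 3 first.
- by move=> om _; rewrite -EFinM lee_fin !mulr_ge0 ?powR_ge0.
- exact: measurable_funeM.
- by move=> om _; rewrite lee_fin mulr_ge0 ?powR_ge0.
rewrite integral_cst// ge0_integralZl//; last by rewrite lee_fin mulr_ge0 ?powR_ge0.
rewrite [X in _ + _ * X](_ : _ = 1); last exact: probability_setT.
rewrite mule1.
have : (c * M^-1 `^ q)%:E * \int[P]_om (`|X om| `^ q)%:E
    <= (c * M^-1 `^ q)%:E * (M `^ q)%:E.
  by rewrite lee_wpmul2l// lee_fin mulr_ge0 ?powR_ge0.
move/leeD => /(_ _ _ (lexx (c * 2 `^ q)%:E)) /le_trans; apply.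
rewrite -EFinM -EFinD lee_fin /centered_moment_const -/c -mulrA -powRM ?(ltW M0)//.
by rewrite mulVf ?gt_eqF// one_powR mulrDr.
Qed.

End SingleProcess.

(** * The average of independent processes *)

Section Average.
Context (R : realType).

Lemma average_spaceD (T : R) N (z : 'I_N -> R * R -> R) :
  (forall i, spaceD T (z i)) ->
  spaceD T (fun t => average (fun i => z i t)).
Proof.
move=> zD; have Ni : 0 <= N%:R^-1 :> R by rewrite invr_ge0.
rewrite /average; split.
- move=> t tD; apply: mulr_ge0 => //; apply: sumr_ge0 => i _.
  by have [+ _ _ _] := zD i; apply.
- move=> s1 t1 t2 sD tD st; rewrite ler_wpM2l//; apply: ler_sum => i _.
  by have [_ + _ _] := zD i; apply.
- move=> t1 s2 t2 sD tD st; rewrite ler_wpM2l//; apply: ler_sum => i _.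
  by have [_ _ + _] := zD i; apply.
- move=> t tT; rewrite big1 ?mulr0// => i _.
  by have [_ _ _ ->] := zD i.
Qed.

Lemma average_le N (x y : 'I_N -> R) : (forall i, x i <= y i) -> average x <= average y.
Proof.
by move=> xy; rewrite /average ler_wpM2l ?invr_ge0//; exact: ler_sum.
Qed.

Lemma average_cst N (c : R) : (0 < N)%N -> average (fun _ : 'I_N => c) = c.
Proof.
move=> N0; rewrite /average sumr_const card_ord -[c *+ N]mulr_natl mulrA mulVf ?mul1r//.
by rewrite pnatr_eq0 -lt0n.
Qed.

Lemma averageB N (x y : 'I_N -> R) :
  average x - average y = average (fun i => x i - y i).
Proof. by rewrite /average -mulrBr sumrB. Qed.

Lemma averageZ N c (x : 'I_N -> R) : average (fun i => c * x i) = c * average x.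
Proof. by rewrite /average -mulr_sumr mulrCA. Qed.

End Average.

Section Constants.
Context (R : realType).
Implicit Types (p s : R) (n : nat).

Definition deviation_const p : R := moment_const p (centered_moment_const p).

Lemma centered_moment_const_ge0 p : 0 <= centered_moment_const p.
Proof. by rewrite mulr_ge0 ?addr_ge0 ?powR_ge0. Qed.

Lemma deviation_const_ge0 p : 2 < p -> 0 <= deviation_const p.
Proof.
move=> p2; have p0 : 0 <= p by lra.
have t0 := taylor_const_ge0 p0; have m0 := centered_moment_const_ge0 p.
by rewrite !mulr_ge0 ?expR_ge0// addr_ge0// mulr_ge0.
Qed.

(** The mesh [eps] at which the moments summed over the net and the
    discretization error have the same order in the number [n] of processes. *)
Definition rate p s n : R :=
  n%:R `^ (- (p * s / (2 * p * s + 2 * s + 2))).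

Lemma rate_gt0 p s n : (0 < n)%N -> 0 < rate p s n.
Proof. by move=> n0; rewrite powR_gt0// ltr0n. Qed.

Lemma rate_le1 p s n : 2 < p -> 0 < s -> (0 < n)%N -> rate p s n <= 1.
Proof.
move=> p2 s0 n0; rewrite /rate -[leRHS](powRr0 (n%:R : R)).
apply: ler_powR; first by rewrite ler1n.
by rewrite oppr_le0 divr_ge0// ?addr_ge0 ?mulr_ge0//; lra.
Qed.

(** Number of net points times moment at one point, equated with [eps^q]. *)
Lemma rate_balance p s n : 2 < p -> 0 < s -> (0 < n)%N ->
  (rate p s n)^-1 * (rate p s n)^-1 `^ s^-1 * n%:R `^ (- (p / 2))
  = rate p s n `^ p.
Proof.
move=> p2 s0 n0.
have D0 : 0 < 2 * p * s + 2 * s + 2 by nra.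
have np : 0 < n%:R :> R by rewrite ltr0n.
rewrite /rate -powRN opprK -!powRrM -!powRD ?(gt_eqF np) ?implybT//.
by congr (_ `^ _); field; rewrite !gt_eqF.
Qed.

Lemma rate_powR p s n :
  rate p s n `^ p = (n%:R `^ (p ^+ 2 * s / (2 * p * s + 2 * s + 2)))^-1.
Proof. by rewrite /rate -powRrM -powRN; congr (_ `^ _); ring. Qed.

End Constants.

Section Family.
Local Open Scope ereal_scope.
Context d (Omega : measurableType d) (R : realType) (P : probability Omega R).

Lemma mfun_exists (f : Omega -> R) : measurable_fun setT f ->
  exists g : {mfun Omega >-> R}, forall om, g om = f om.
Proof.
move=> mf; pose mixin := isMeasurableFun.Build _ _ _ _ f mf.
by pose g : {mfun Omega >-> R} := HB.pack f mixin; exists g.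
Qed.

Lemma ae_all_seq (I : eqType) (s : seq I) (Q : I -> Omega -> Prop) :
  (forall i, i \in s -> {ae P, forall om, Q i om}) ->
  {ae P, forall om, forall i, i \in s -> Q i om}.
Proof.
elim: s => [_|i s IH h]; first exact: aeW.
have h1 : {ae P, forall om, Q i om} by apply: h; rewrite mem_head.
have h2 : {ae P, forall om, forall j, j \in s -> Q j om}.
  by apply: IH => j js; apply: h; rewrite inE js orbT.
apply: filterS2 h1 h2 => om Qi Qs j; rewrite inE => /predU1P[->//|]; exact: Qs.
Qed.

Variables (T q r M : R) (N : nat) (Z : 'I_N -> Omega -> R * R -> R) (w : 'I_N -> R).
Hypotheses (T0 : (0 < T)%R) (q2 : (2 < q)%R) (r0 : (0 < r)%R) (M0 : (0 < M)%R).
Hypothesis N0 : (0 < N)%N.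
Hypothesis ZD : forall i, D_random_variable P T (Z i).
Hypothesis Zind : D_independent P T Z.
Hypothesis w0 : forall i, (0 <= w i)%R.
Hypothesis Zq : forall i,
  'E_P[fun om => (Z i om (0, T) `^ q)%R] `^ q^-1 <= M%:E.
Hypothesis Zr : forall i (s t : R * R), Delta T s -> Delta T t ->
  `| 'E_P[fun om => (Z i om t - Z i om s)%R] |
    <= (M * w i * (`|t.1 - s.1| `^ r + `|t.2 - s.2| `^ r))%:E.

Let ZD1 i om : spaceD T (Z i om) := (ZD i).1 om.
Let ZD2 i t : Delta T t -> ae_random_variable P (fun om => Z i om t) := (ZD i).2 t.

(** Events on measurable versions differ by null sets from events in the
    sigma-algebras generated by the processes, and for such pairs independence
    gives the product rule. *)
Lemma chain_independent_standardized t (X : 'I_N -> {mfun Omega >-> R})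
    (F : 'I_N -> R) (xi : nat -> {mfun Omega >-> R}) : Delta T t ->
  (forall i, {ae P, forall om, Z i om t = X i om}) ->
  (forall (i : 'I_N) om, xi i om = (X i om - F i) / M)%R ->
  chain_independent P N xi.
Proof.
move=> tD ZX xiE k B kN mB.
pose E (i : 'I_N) := xi i @^-1` B i.
have mE i : measurable (E i).
  by rewrite -[E i]setTI; exact: measurable_funP.
pose A (i : 'I_N) := (fun om => Z i om t) @^-1` [set x : R | B i ((x - F i) / M)%R].
have mB' (i : 'I_N) : measurable [set x : R | B i ((x - F i) / M)%R].
  rewrite -[X in measurable X]setTI.
  have : measurable_fun setT (fun x : R => (x - F i) / M)%R.
    by apply: measurable_funM => //; exact: measurable_funB.
  by move=> /(_ measurableT _ (mB i)).
have sA i : sigma_D T (Z i) (A i).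
  by apply: sub_sigma_algebra; exists t, [set x : R | B i ((x - F i) / M)%R].
have nA i : P.-negligible (A i `+` E i).
  apply: negligibleS (ZX i) => om /= AE ZXE; move: AE; rewrite /A /E.
  by case=> -[]; rewrite /= xiE ZXE.
pose J k : {set 'I_N} := finset (fun i : 'I_N => (k <= i)%N).
have PJ j : P (tail_event xi N j B) = \prod_(i in J j) P (E i).
  rewrite -(@Zind (J j) A E)//; congr (P _); apply/seteqP; split=> om h.
    by move=> i /=; rewrite inE => ji; apply: h => /=; rewrite ji ltn_ord.
  move=> i /= /andP[ji iN]; apply: (h (Ordinal iN)) => /=.
  by rewrite inE.
rewrite !PJ (bigD1 (Ordinal kN))/=; last by rewrite inE.
congr (_ * _); apply: eq_bigl => i.
by rewrite !inE ltn_neqAle eq_sym andbC -val_eqE/= eq_sym.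
Qed.

(** The sum of the standardized variables is [N / M] times the deviation of the
    average; [sum_moment] then gives the factor [N^(-q) N^(q/2)]. *)
Lemma average_moment t (X : 'I_N -> {mfun Omega >-> R}) : Delta T t ->
  (forall i, {ae P, forall om, Z i om t = X i om}) ->
  \int[P]_om (`|average (fun i => X i om) - average (fun i => mean_fun P (Z i) t)| `^ q)%:E
   <= (M `^ q * deviation_const q * N%:R `^ (- (q / 2)))%:E.
Proof.
move=> tD ZX.
have q0 : (0 < q)%R by have := q2; lra.
have Np : (0 < N%:R :> R)%R by rewrite ltr0n.
pose F i := mean_fun P (Z i) t.
have ex (k : nat) : exists g : {mfun Omega >-> R},
    forall i : 'I_N, k = i :> nat -> forall om, (g om = (X i om - F i) / M)%R.
  have [kN|kN] := ltnP k N; last first.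
    exists (cst 0%R) => i ki; by move: kN; rewrite ki leqNgt ltn_ord.
  have [|g hg] := @mfun_exists (fun om => (X (Ordinal kN) om - F (Ordinal kN)) / M)%R.
    by apply: measurable_funM => //; exact: measurable_funB.
  exists g => i ki om; rewrite hg; suff -> : i = Ordinal kN by [].
  by apply: val_inj; rewrite /= -ki.
have {ex} [xi hxi] := choice ex.
have xiE (i : 'I_N) om : (xi i om = (X i om - F i) / M)%R by exact: hxi.
have ind := chain_independent_standardized tD ZX xiE.
have mom k : (k < N)%N ->
   [/\ P.-integrable setT (EFin \o xi k), \int[P]_om (xi k om)%:E = 0 &
       \int[P]_om (`|xi k om| `^ q)%:E <= (centered_moment_const q)%:E].
  move=> kN; pose i := Ordinal kN.
  exact: (standardized_moment T0 q2 M0 (ZD1 i) (Zq i) (ZD2 i) tD (ZX i) (xiE i)).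
have := sum_moment q2 (centered_moment_const_ge0 q) N0 ind mom.
have sumE om : (`|average (fun i => X i om) - average F| `^ q =
    (M / N%:R) `^ q * `|partial_sum xi N om| `^ q)%R.
  rewrite -powRM ?divr_ge0 ?(ltW M0)// averageB.
  congr (_ `^ _)%R; rewrite -[X in (X * _)%R]ger0_norm ?divr_ge0 ?(ltW M0)// -normrM.
  congr (`|_|)%R; rewrite /average /partial_sum.
  under [in RHS]eq_bigr do rewrite xiE.
  rewrite -mulr_suml; set S := (\sum_(i < N) _)%R.
  by field; rewrite !gt_eqF.
under [in X in _ -> X <= _]eq_integral do rewrite sumE EFinM.
rewrite ge0_integralZl//; last 2 first.
- by apply: measurable_powR_norm; exact: measurable_funP.
- by rewrite lee_fin powR_ge0.
set I := \int[P]_om _ => Ile.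
apply: (@le_trans _ _ (((M / N%:R) `^ q)%:E *
    (moment_const q (centered_moment_const q) * N%:R `^ (q / 2))%:E)).
  by rewrite lee_wpmul2l// lee_fin powR_ge0.
rewrite -EFinM lee_fin /deviation_const powRM ?invr_ge0 ?(ltW M0)//.
rewrite -powR_inv1// -powRrM mulN1r.
rewrite (_ : (- (q / 2)) = - q + q / 2)%R; last lra.
rewrite powRD; last by rewrite (gt_eqF Np) implybT.
by rewrite le_eqVlt; apply/orP; left; apply/eqP; ring.
Qed.

Definition mean_average (t : R * R) : R := average (fun i => mean_fun P (Z i) t).

Lemma mean_average_spaceD : spaceD T mean_average.
Proof.
apply: average_spaceD => i.
exact: (mean_spaceD T0 q2 M0 (ZD1 i) (Zq i) (ZD2 i)).
Qed.

Lemma mean_average_hoelder (s t : R * R) : Delta T s -> Delta T t ->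
  (`|mean_average t - mean_average s| <=
    M * average w * (`|t.1 - s.1| `^ r + `|t.2 - s.2| `^ r))%R.
Proof.
move=> sD tD; set D := (`|t.1 - s.1| `^ r + `|t.2 - s.2| `^ r)%R.
rewrite /mean_average averageB.
apply: (@le_trans _ _ (average (fun i => M * D * w i))%R).
  rewrite /average normrM ger0_norm ?invr_ge0// ler_wpM2l ?invr_ge0//.
  apply: (le_trans (ler_norm_sum _ _ _)); apply: ler_sum => i _.
  have := Zr i sD tD.
  rewrite (mean_diff T0 q2 M0 (ZD1 i) (Zq i) (ZD2 i) sD tD) lee_fin -/D.
  by move/le_trans; apply; rewrite mulrAC.
by rewrite averageZ; rewrite mulrAC.
Qed.

Lemma mean_average_le2M t : Delta T t -> (mean_average t <= 2 * M)%R.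
Proof.
move=> tD; rewrite -[leRHS](@average_cst R N)//; apply: average_le => i.
exact: (mean_le2M T0 q2 M0 (ZD1 i) (Zq i) (ZD2 i) tD).
Qed.

Lemma versions_exist : exists X : 'I_N -> R * R -> {mfun Omega >-> R},
  forall i t, Delta T t -> {ae P, forall om, Z i om t = X i t om}.
Proof.
have ex (it : 'I_N * (R * R)) : exists X : {mfun Omega >-> R},
    Delta T it.2 -> {ae P, forall om, Z it.1 om it.2 = X om}.
  have [/(ZD2 it.1)[X hX]|nD] := pselect (Delta T it.2); first by exists X.
  by exists (cst 0%R).
have [X hX] := choice ex.
by exists (fun i t => X (i, t)) => i t; exact: (hX (i, t)).
Qed.

Lemma mean_average_expectation t : Delta T t ->
  'E_P[fun om => average (fun i => Z i om t)] = (mean_average t)%:E.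
Proof.
move=> tD; have [X hX] := versions_exist.
have [|g gE] := @mfun_exists (fun om => average (fun i => X i t om)).
  apply: measurable_funM => //; apply: measurable_sum => i.
  exact: measurable_funP.
have Zg : {ae P, forall om, average (fun i => Z i om t) = g om}.
  have h : {ae P, forall om, forall i, i \in enum 'I_N -> Z i om t = X i t om}.
    by apply: ae_all_seq => i _; exact: hX.
  apply: filterS h => om h; rewrite gE /average; congr (_ * _)%R.
  by apply: eq_bigr => i _; rewrite h ?mem_enum.
have iX i : P.-integrable setT (EFin \o X i t).
  exact: (version_integrable T0 q2 M0 (ZD1 i) (Zq i) tD (hX i t tD)).
rewrite (ae_eq_expectation Zg) unlock.
under eq_integral do rewrite gE /average EFinM -sumEFin.
rewrite integralZl//; last first.
  by apply: integrable_sum => // i _; exact: iX.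
rewrite integral_sum// /mean_average /average EFinM -sumEFin; congr (_ * _).
apply: eq_bigr => i _.
exact: (mean_version T0 q2 M0 (ZD1 i) (Zq i) (ZD2 i) tD (hX i t tD)).
Qed.

(** [H] is the sum over the net of the [q]-th powers of the deviations, so that
    its [q]-th root dominates each of them and [finite_net] applies. *)
Lemma uniform_deviation : exists H : {mfun Omega >-> R},
  [/\ forall om, (0 <= H om)%R,
      \int[P]_om (H om)%:E <= (M `^ q * rate q r N `^ q *
        (6 * deviation_const q * (2 * T * average w `^ r^-1 + 1)))%:E &
      {ae P, forall om t, Delta T t ->
        (`|average (fun i => Z i om t) - mean_average t| `^ q <=
          2 `^ (q - 1) * (H om + (4 * M * rate q r N) `^ q))%R}].
Proof.
have q0 : (0 < q)%R by have := q2; lra.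
have q1 : (1 <= q)%R by have := q2; lra.
have W0 : (0 <= average w)%R by rewrite /average mulr_ge0 ?invr_ge0// sumr_ge0.
have e0 := rate_gt0 q r N0; have e1 := rate_le1 q2 r0 N0.
set e := rate q r N in e0 e1 *.
have [pts [ptsD ptsN ptsdev]] := finite_net T0 r0 W0 M0 e0 e1 mean_average_spaceD
  mean_average_le2M mean_average_hoelder.
have [X hX] := versions_exist.
pose h p om := (`|average (fun i => X i p om) - mean_average p| `^ q)%R.
have mhE p : measurable_fun setT (fun om => (h p om)%:E).
  apply: measurable_powR_norm.
  apply: measurable_funB => //; apply: measurable_funM => //.
  by apply: measurable_sum => i; exact: measurable_funP.
have mh p : measurable_fun setT (h p) by apply/measurable_EFinP; exact: mhE.
have [H HE] := @mfun_exists (fun om => \sum_(p <- pts) h p om)%R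
  (measurable_sum _ (fun p => mh p)).
have h0 p om : (0 <= h p om)%R by exact: powR_ge0.
have H0 om : (0 <= H om)%R by rewrite HE sumr_ge0.
have c0 := deviation_const_ge0 q2.
exists H; split => //.
- under eq_integral do rewrite HE -sumEFin.
  rewrite ge0_integral_sum//; last by move=> p om _; rewrite lee_fin h0.
  pose b := (M `^ q * deviation_const q * N%:R `^ (- (q / 2)))%R.
  have b0 : (0 <= b)%R by rewrite mulr_ge0 ?powR_ge0// mulr_ge0 ?powR_ge0.
  apply: (@le_trans _ _ ((size pts)%:R * b)%:E).
    have -> : ((size pts)%:R * b = \sum_(p <- pts) b)%R.
      by rewrite big_const_seq count_predT iter_addr_0 mulr_natl.
    rewrite -sumEFin.
    rewrite big_seq [leRHS]big_seq; apply: lee_sum => p ppts.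
    apply: average_moment; first exact: ptsD.
    by move=> i; apply: hX; exact: ptsD.
  rewrite lee_fin; apply: (le_trans (ler_wpM2r b0 ptsN)).
  rewrite /b -(rate_balance q2 r0 N0) -/e.
  by rewrite le_eqVlt; apply/orP; left; apply/eqP; ring.
have ae1 : {ae P, forall om, forall p, p \in pts ->
    forall i, i \in enum 'I_N -> Z i om p = X i p om}.
  apply: ae_all_seq => p ppts; apply: ae_all_seq => i _.
  by apply: hX; exact: ptsD.
apply: filterS ae1 => om ZX t tD.
have Me0 : (0 <= 4 * M * e)%R by rewrite !mulr_ge0// ltW.
have yD : spaceD T (fun t => average (fun i => Z i om t)).
  by apply: average_spaceD => i; exact: ZD1.
have dev := ptsdev _ yD (H om `^ q^-1)%R.
apply: (@le_trans _ _ ((H om `^ q^-1 + 4 * M * e) `^ q)%R).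
  rewrite ge0_ler_powR ?nnegrE ?addr_ge0 ?powR_ge0 ?(ltW q0)//.
  apply: dev => // p ppts.
  have hp : (h p om <= H om)%R.
    rewrite HE (big_rem p)//= lerDl; exact: sumr_ge0.
  have -> : average (fun i => Z i om p) = average (fun i => X i p om).
    by rewrite /average; congr (_ * _)%R; apply: eq_bigr => i _; rewrite ZX// mem_enum.
  set x := (`|_|)%R.
  have -> : x = (h p om `^ q^-1)%R.
    by rewrite /h -powRrM mulfV ?gt_eqF// powRr1.
  by rewrite ge0_ler_powR ?nnegrE ?invr_ge0 ?(ltW q0).
apply: (le_trans (powRD_convex q1 _ _)) => //; first exact: powR_ge0.
by rewrite -powRrM mulVf ?gt_eqF// powRr1.
Qed.

(** Both parts of the theorem need only this measurable majorant, through its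
    integral and through its values. *)
Lemma deviation_majorant : exists h : {mfun Omega >-> R},
  [/\ forall om, (0 <= h om)%R,
      \int[P]_om (h om)%:E <= (M `^ q * 2 `^ (q - 1)
           / N%:R `^ (q ^+ 2 * r / (2 * q * r + 2 * r + 2))
         * (6 * deviation_const q * (2 * T * average w `^ r^-1 + 1)
            + 2 `^ (2 * q)))%:E &
      {ae P, forall om t, Delta T t ->
        (`|average (fun i => Z i om t) - mean_average t| `^ q <= h om)%R}].
Proof.
have [H [H0 HI Hae]] := uniform_deviation.
have e0 := rate_gt0 q r N0.
rewrite -rate_powR; set e := rate q r N in e0 HI Hae *.
pose b := ((4 * M * e) `^ q)%R.
have b0 : (0 <= b)%R by exact: powR_ge0.
have k0 : (0 <= 2 `^ (q - 1) :> R)%R by exact: powR_ge0.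
have mH : measurable_fun setT (fun om => (H om)%:E).
  by apply/measurable_EFinP; exact: measurable_funP.
have [|h hE] := @mfun_exists (fun om => 2 `^ (q - 1) * (H om + b))%R.
  by apply: measurable_funM => //; exact: measurable_funD.
exists h; split.
- by move=> om; rewrite hE mulr_ge0// addr_ge0.
- under eq_integral do rewrite hE EFinM EFinD.
  rewrite ge0_integralZl//; last 2 first.
  + exact: (emeasurable_funD mH).
  + by move=> om _; rewrite -EFinD lee_fin addr_ge0.
  rewrite ge0_integralD//; last by move=> om _; rewrite lee_fin.
  rewrite integral_cst//.
  rewrite [X in _ * (_ + _ * X)](_ : _ = 1); last exact: probability_setT.
  rewrite mule1; apply: le_trans (lee_wpmul2l _ (leeD2r _ HI)) _.
    by rewrite lee_fin.
  rewrite -EFinD -EFinM lee_fin.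
  have -> : (b = M `^ q * e `^ q * 2 `^ (2 * q))%R.
    rewrite /b powRM ?mulr_ge0 ?(ltW M0) ?(ltW e0)// powRM ?(ltW M0)//.
    rewrite powRrM (_ : 2 `^ 2 = 4 :> R)%R; last first.
      by rewrite (powR_mulrn 2)//; ring.
    by ring.
  by rewrite le_eqVlt; apply/orP; left; apply/eqP; ring.
- by apply: filterS Hae => om hom t tD; rewrite hE; exact: hom.
Qed.

End Family.

(** * Summable moments and almost sure convergence *)

Section AlmostSureConvergence.
Context (R : realType).

(** After division by [x^(-s)] this is [1 + s/x <= (1 - 1/x)^(-s)], where the
    right-hand side is at least [expR (s/x)]. *)
Lemma powRN_telescope (s x : R) : 0 < s -> 1 < x ->
  s * x `^ (- (1 + s)) <= (x - 1) `^ (- s) - x `^ (- s).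
Proof.
move=> s0 x1.
have x0 : 0 < x by lra.
have y0 : 0 < 1 - x^-1 by rewrite subr_gt0 invf_lt1.
have E1 : x `^ (- (1 + s)) = x `^ (- s) * x^-1.
  rewrite opprD addrC powRD; last by rewrite (gt_eqF x0) implybT.
  by rewrite powR_inv1// ltW.
have E2 : (x - 1) `^ (- s) = x `^ (- s) * (1 - x^-1) `^ (- s).
  rewrite -powRM ?ltW//; congr (_ `^ _).
  by rewrite mulrBr mulr1 divff// gt_eqF.
have key : 1 + s * x^-1 <= (1 - x^-1) `^ (- s).
  apply: (le_trans (expR_ge1Dx _)).
  rewrite /powR (gt_eqF y0) ler_expR mulNr -mulrN ler_wpM2l ?(ltW s0)//.
  rewrite lerNr; apply: le_ln1Dx; lra.
rewrite E1 E2; have : 0 <= x `^ (- s) by exact: powR_ge0.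
by move=> /ler_wpM2l /(_ _ _ key); lra.
Qed.

Lemma sum_powRN_le (s : R) n : 0 < s ->
  \sum_(0 <= k < n) k%:R `^ (- (1 + s)) <= 1 + s^-1.
Proof.
move=> s0.
have i0 : 0 < s^-1 by rewrite invr_gt0.
have H m : \sum_(0 <= k < m.+2) k%:R `^ (- (1 + s))
    <= 1 + s^-1 - s^-1 * m.+1%:R `^ (- s).
  elim: m => [|m IH].
    rewrite big_nat_recr//= big_nat1 powR0 ?add0r; last first.
      by rewrite oppr_eq0 gt_eqF//; lra.
    by rewrite !one_powR; lra.
  rewrite big_nat_recr//=; apply: (le_trans (lerD IH (lexx _))).
  have := @powRN_telescope s m.+2%:R s0 _.
  rewrite ltr1n => /(_ isT).
  rewrite (_ : m.+2%:R - 1 = m.+1%:R :> R); last by rewrite -natr1 addrK.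
  move=> h; have : s^-1 * (s * m.+2%:R `^ (- (1 + s))) <=
    s^-1 * (m.+1%:R `^ (- s) - m.+2%:R `^ (- s)) by rewrite ler_pM2l.
  by rewrite mulrA mulVf ?gt_eqF// mul1r; lra.
apply: (@le_trans _ _ (\sum_(0 <= k < n.+2) k%:R `^ (- (1 + s)))).
  rewrite (@big_cat_nat _ _ _ n 0 n.+2)//=; last by rewrite ltnW.
  by rewrite lerDl sumr_ge0// => i _; exact: powR_ge0.
apply: (le_trans (H n)).
by rewrite gerBl mulr_ge0 ?powR_ge0// ltW.
Qed.

Lemma cvg0_of_powR (q : R) (c : nat -> R) : 0 < q ->
  (forall n, 0 <= c n) -> c @ \oo --> (0 : R) ->
  (fun n => c n `^ q^-1) @ \oo --> (0 : R).
Proof.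
move=> q0 c0 cc; apply/cvgrPdist_le => e e0.
have eq0 : 0 < e `^ q by exact: powR_gt0.
move/cvgrPdist_le : cc => /(_ _ eq0); apply: filterS => n.
rewrite !sub0r !normrN (ger0_norm (c0 n)) (ger0_norm (powR_ge0 _ _)) => h.
have -> : e = e `^ q `^ q^-1 by rewrite -powRrM mulfV ?gt_eqF// powRr1// ltW.
by rewrite ge0_ler_powR ?nnegrE ?invr_ge0 ?(ltW q0)// ltW.
Qed.

Local Open Scope ereal_scope.
Context d (Omega : measurableType d) (P : probability Omega R).

(** The sum of the [h n] has finite integral, so it is almost surely finite and
    its terms tend to [0]. *)
Lemma ae_cvg0_of_summable (h : nat -> {mfun Omega >-> R}) (B s : R) :
  (0 < s)%R -> (0 <= B)%R -> (forall n om, (0 <= h n om)%R) ->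
  (forall n, \int[P]_om (h n om)%:E <= (B * n%:R `^ (- (1 + s)))%:E) ->
  {ae P, forall om, (fun n => h n om) @ \oo --> (0%R : R)}.
Proof.
move=> s0 B0 h0 hB.
have mh n : measurable_fun setT (fun om => (h n om)%:E).
  by apply/measurable_EFinP; exact: measurable_funP.
pose S om := \sum_(n <oo) (h n om)%:E.
have S0 om : 0 <= S om by apply: nneseries_ge0 => n _ _; rewrite lee_fin.
have iS : \int[P]_om S om <= (B * (1 + s^-1))%:E.
  rewrite /S integral_nneseries//; last by move=> n om _; rewrite lee_fin.
  apply: lime_le.
    by apply: is_cvg_nneseries => n _ _; apply: integral_ge0 => om _; rewrite lee_fin.
  apply: nearW => n; apply: (@le_trans _ _ (\sum_(0 <= k < n) (B * k%:R `^ (- (1 + s)))%:E)).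
    by apply: lee_sum => k _; exact: hB.
  rewrite sumEFin -mulr_sumr lee_fin ler_wpM2l//.
  exact: sum_powRN_le.
have mS : measurable_fun setT S.
  by apply: ge0_emeasurable_sum => // n om _ _; rewrite lee_fin.
have intS : P.-integrable setT S.
  apply/integrableP; split => //.
  under eq_integral do rewrite gee0_abs//.
  by rewrite (le_lt_trans iS)// ltry.
apply: filterS (integrable_ae measurableT intS) => om /(_ I) Sfin.
apply: (@cvg_series_cvg_0 R R).
apply: nondecreasing_is_cvgn.
  apply/nondecreasing_seqP => n.
  by rewrite /series /= big_nat_recr//= lerDl.
exists (fine (S om)) => _ [n _ <-].
rewrite -lee_fin fineK// /series /= -sumEFin.
by apply: nneseries_lim_ge => k _ _; rewrite lee_fin.
Qed.

End AlmostSureConvergence.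

(** * The theorem *)

(** The constant is the [q]-th root of the one produced by
    [deviation_majorant], increased by [1] to make it positive. *)
Theorem theorem1 (R : realType) (q : R) (hq : 2 < q) :
  exists C : R, 0 < C /\
  forall (T : R) (hT : 0 < T)
    (d : measure_display) (Omega : measurableType d) (P : probability Omega R)
    (r : R) (hr : 0 < r)
    (Z : forall N : nat, 'I_N -> Omega -> R * R -> R)
    (M : nat -> R) (w : forall N : nat, 'I_N -> R)
    (hZ : forall (N : nat) (i : 'I_N), D_random_variable P T (Z N i))
    (hind : forall N : nat, (0 < N)%N -> D_independent P T (Z N))
    (hM : forall N : nat, (0 < N)%N -> 0 < M N)
    (hw : forall (N : nat) (i : 'I_N), 0 <= w N i)
    (hi : forall (N : nat) (i : 'I_N),
      ('E_P[fun om => (Z N i om (0, T) `^ q)%R] `^ q^-1 <= (M N)%:E)%E)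
    (hii : forall (N : nat) (i : 'I_N) (s t : R * R),
      Delta T s -> Delta T t ->
      (`| 'E_P[fun om => (Z N i om t - Z N i om s)%R] |
        <= (M N * w N i * (`|t.1 - s.1| `^ r + `|t.2 - s.2| `^ r))%:E)%E),
  let wbar (N : nat) : R := average (w N) in
  let Y (N : nat) (om : Omega) (t : R * R) : R :=
    average (fun i : 'I_N => Z N i om t) in
  (forall N0 : nat, is_N0 q r N0 -> forall N : nat, (N0 <= N)%N ->
    (\int[P]_om ereal_sup
        [set `| (Y N om t)%:E - 'E_P[fun om' => Y N om' t] | `^ q
          | t in Delta T]
     <= (M N `^ q * 2 `^ (q - 1)
           / N%:R `^ (q ^+ 2 * r / (2 * q * r + 2 * r + 2))
         * (C `^ q * (2 * T * wbar N `^ r^-1 + 1) + 2 `^ (2 * q)))%:E)%E)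
  /\
  ((exists K : R, forall N : nat, (0 < N)%N ->
      `|M N| <= K /\ `|wbar N| <= K) ->
   (q ^+ 2 - 2 * q - 2) * r > 2 ->
   {ae P, forall om,
     (fun N : nat => ereal_sup
        [set `| (N%:R^-1)%:E *
                \sum_(i < N)
                  ((Z N i om t)%:E - 'E_P[fun om' => Z N i om' t]) |%E
          | t in Delta T]) @ \oo --> 0%E}).
Proof.
have q0 : 0 < q by lra.
have D0 := deviation_const_ge0 hq.
pose D := 6 * deviation_const q + 1.
have Dp : 0 < D by rewrite /D; lra.
exists (D `^ q^-1); split; first exact: powR_gt0.
move=> T hT d Omega P r hr Z M w hZ hind hM hw hi hii wbar Y.
have Cq : (D `^ q^-1) `^ q = D by rewrite -powRrM mulVf ?gt_eqF// powRr1// ltW.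
have Delta0 : Delta T (0, 0) by split => //=; split => //; exact: ltW.
have dev N (N0 : (0 < N)%N) := deviation_majorant hT hq hr (hM N N0) N0 (hZ N)
  (hind N N0) (hw N) (hi N) (hii N).
have mean N (N0 : (0 < N)%N) t (tD : Delta T t) :=
  mean_average_expectation hT hq (hM N N0) (hZ N) (hi N) tD.
have wbar0 N : 0 <= wbar N.
  by rewrite /wbar /average mulr_ge0 ?invr_ge0// sumr_ge0.
have bound x y : 0 <= x -> x <= y ->
    6 * deviation_const q * (2 * T * x `^ r^-1 + 1) <= D * (2 * T * y `^ r^-1 + 1).
  move=> x0 xy; have y0 := le_trans x0 xy.
  have p0 : 0 <= x `^ r^-1 by exact: powR_ge0.
  have p1 : x `^ r^-1 <= y `^ r^-1.
    by rewrite ge0_ler_powR ?nnegrE ?invr_ge0 ?(ltW hr).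
  have T2 : 0 <= 2 * T by rewrite mulr_ge0// ltW.
  apply: ler_pM.
  - by rewrite mulr_ge0.
  - by rewrite addr_ge0// mulr_ge0.
  - by rewrite /D; lra.
  - by rewrite lerD2r ler_wpM2l.
split.
- move=> N0 [[N00 _] _] N NN0.
  have Np : (0 < N)%N by exact: leq_trans NN0.
  have [h [h0 hI hae]] := dev N Np.
  rewrite Cq; apply: (@le_trans _ _ (\int[P]_om (h om)%:E)%E).
    apply: ae_le_integral_ge0.
    + move=> om; apply: le_ereal_sup_tmp; eexists; first by exists (0, 0).
      exact: poweR_ge0.
    + by move=> om; rewrite lee_fin.
    + by apply/measurable_EFinP; exact: measurable_funP.
    + apply: filterS hae => om hom.
      apply: ge_ereal_sup => _ [t tD <-].
      by rewrite /Y (mean N Np t tD) -EFinB /= lee_fin; exact: hom.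
  apply: (le_trans hI); rewrite lee_fin ler_wpM2l//.
    by rewrite divr_ge0 ?powR_ge0// mulr_ge0 ?powR_ge0.
  by rewrite lerD2r; apply: bound => //; exact: wbar0.
- move=> [K hK] hqr.
  have K0 : 0 <= K by have [+ _] := hK 1%N isT; apply: le_trans.
  pose a := q ^+ 2 * r / (2 * q * r + 2 * r + 2).
  have s0 : 0 < a - 1.
    rewrite subr_gt0 /a ltr_pdivlMr; last by nra.
    by nra.
  pose B := K `^ q * 2 `^ (q - 1) * (D * (2 * T * K `^ r^-1 + 1) + 2 `^ (2 * q)).
  have B1 : 0 <= D * (2 * T * K `^ r^-1 + 1) + 2 `^ (2 * q).
    rewrite addr_ge0 ?powR_ge0// mulr_ge0 ?(ltW Dp)// addr_ge0// mulr_ge0 ?powR_ge0//.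
    by rewrite mulr_ge0// ltW.
  have B0 : 0 <= B by rewrite mulr_ge0// mulr_ge0 ?powR_ge0.
  have ex N : exists h : {mfun Omega >-> R},
      [/\ forall om, 0 <= h om,
          (\int[P]_om (h om)%:E <= (B * N%:R `^ (- (1 + (a - 1))))%:E)%E &
          {ae P, forall om, (0 < N)%N -> forall t, Delta T t ->
            `|average (fun i => Z N i om t) - mean_average P (Z N) t| `^ q <= h om}].
    have [->|Np] := posnP N.
      exists (cst 0); split => //; last exact: aeW.
      by rewrite integral0_eq// lee_fin mulr_ge0 ?powR_ge0.
    have [h [h0 hI hae]] := dev N Np.
    exists h; split => //; last by apply: filterS hae => om hom _.
    apply: (le_trans hI); rewrite lee_fin.
    rewrite (_ : - (1 + (a - 1)) = - a); last by ring.
    rewrite powRN -/a /B [leRHS]mulrAC.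
    have [MK wK] := hK N Np.
    apply: ler_pM.
    - by rewrite divr_ge0 ?powR_ge0// mulr_ge0 ?powR_ge0.
    - rewrite addr_ge0 ?powR_ge0// mulr_ge0//; first by rewrite mulr_ge0.
      by rewrite addr_ge0// mulr_ge0 ?powR_ge0// mulr_ge0// ltW.
    - rewrite ler_wpM2r ?invr_ge0 ?powR_ge0// ler_wpM2r ?powR_ge0//.
      rewrite ge0_ler_powR ?nnegrE ?(ltW q0) ?(ltW (hM N Np))//.
      exact: le_trans (ler_norm _) MK.
    - rewrite lerD2r; apply: bound; first exact: wbar0.
      exact: le_trans (ler_norm _) wK.
  have {ex} [h hP] := choice ex.
  have hcvg := ae_cvg0_of_summable s0 B0 (fun n => let: And3 h0 _ _ := hP n in h0)
    (fun n => let: And3 _ hI _ := hP n in hI).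
  have hdom : {ae P, forall om N, (0 < N)%N -> forall t, Delta T t ->
      `|average (fun i => Z N i om t) - mean_average P (Z N) t| `^ q <= h N om}.
    by apply/ae_foralln => N; have [] := hP N.
  apply: filterS2 hcvg hdom => om cvgh domh.
  have h0 n : 0 <= h n om by have [+ _ _] := hP n; apply.
  have cvgb := cvg0_of_powR q0 h0 cvgh.
  apply: (@squeeze_cvge _ _ _ _ (cst 0%E) _ (fun n => (h n om `^ q^-1)%:E)).
  + near=> n; apply/andP; split.
      apply: le_ereal_sup_tmp; eexists; first by exists (0, 0).
      exact: abse_ge0.
    have np : (0 < n)%N by near: n; exact: nbhs_infty_gt.
    apply: ge_ereal_sup => _ [t tD <-].
    have -> : (\sum_(i < n) ((Z n i om t)%:E - 'E_P[fun om' => Z n i om' t]) =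
        (\sum_(i < n) (Z n i om t - mean_fun P (Z n i) t))%:E)%E.
      rewrite -sumEFin; apply: eq_bigr => i _; rewrite EFinB.
      by rewrite (mean_fin hT hq (hM n np) ((hZ n i).1) (hi n i) ((hZ n i).2) tD).
    rewrite -EFinM /= lee_fin.
    have := domh n np t tD; rewrite averageB /average.
    set x := `|_| => hx; have x0 : 0 <= x by exact: normr_ge0.
    have -> : x = x `^ q `^ q^-1 by rewrite -powRrM mulfV ?gt_eqF// powRr1.
    by rewrite ge0_ler_powR ?nnegrE ?invr_ge0 ?powR_ge0 ?(ltW q0).
  + exact: cvg_cst.
  + by apply/fine_cvgP; split; [exact: nearW | exact: cvgb].
Unshelve. all: by end_near.
Qed.
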